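(* Let $(\mathcal H_t)_{t>0}$ be the Ornstein--Uhlenbeck semigroup on $\mathbb R^n$ determined by $Q$ and $B$, with invariant measure $\gamma_\infty$. Let $\varrho\ge1$ and $1<p<\infty$. Then there is a constant $C<\infty$ such that for all $f\in L^p(\gamma_\infty)$ $$\big\|\,\|\mathcal H_tf(\cdot)\|_{v(\varrho),[1,\infty)}\big\|_{L^p(\gamma_\infty)}\le C\,\|f\|_{L^p(\gamma_\infty)} ,$$ where $C$ depends only on $n,Q,B,p$.
   Context: Fix $n\ge 1$, a real symmetric positive definite $n\times n$ matrix $Q$, and a real $n\times n$ matrix $B$ all of whose eigenvalues have negative real parts. For $t\in(0,+\infty]$ let $Q_t=\int_0^t e^{sB}Qe^{sB^*}\,ds$ and let $\gamma_t$ be the Gaussian probability measure $d\gamma_t(x)=(2\pi)^{-n/2}(\det Q_t)^{-1/2}e^{-\frac12\langle Q_t^{-1}x,x\rangle}\,dx$. The Ornstein--Uhlenbeck semigroup is $\mathcal H_t f(x)=\int_{\mathbb R^n} f(e^{tB}x-y)\,d\gamma_t(y)$ for $t>0$, $x\in\mathbb R^n$, $f\in L^1(\gamma_\infty)$; $\gamma_\infty$ is its invariant measure. For an interval $\mathcal I\subset(0,\infty)$ and $1\le\varrho<\infty$, the variation seminorm of order $\varrho$ is $\|\mathcal H_tf(x)\|_{v(\varrho),\mathcal I}=\sup\big(\sum_{i=1}^N|\mathcal H_{t_i}f(x)-\mathcal H_{t_{i-1}}f(x)|^\varrho\big)^{1/\varrho}$, the supremum being over all finite increasing sequences $(t_i)_0^N$,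 $N\ge1$, of points in $\mathcal I$. *)

(* Defs.v *)
From HB Require Import structures.
From mathcomp Require Import all_boot all_order all_algebra.
From mathcomp Require Import complex.
From mathcomp Require Import all_classical all_reals all_analysis measurable_realfun.

Set Implicit Arguments.
Unset Strict Implicit.
Unset Printing Implicit Defensive.

Import Order.TTheory GRing.Theory Num.Theory.
Import numFieldNormedType.Exports.

Local Open Scope classical_set_scope.
Local Open Scope ring_scope.

(* Points of R^n are column vectors, which carry the
   sigma-algebra generated by the coordinates, that is, the Borel one. *)

Definition measure_cV_display : measure_display.
Proof. exact: default_measure_display. Qed.

Section measurable_cV.
Variables (R : realType) (n : nat).

Definition cVcoord (i : 'I_n) (x : 'cV[R]_n) : measurableTypeR R := x i 0.

Let cV_set0 : g_sigma_preimage cVcoord set0.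
Proof. exact: sigma_algebra0. Qed.

Let cV_setC A : g_sigma_preimage cVcoord A -> g_sigma_preimage cVcoord (~` A).
Proof. exact: sigma_algebraC. Qed.

Let cV_bigcup (F : (set 'cV[R]_n)^nat) :
  (forall i, g_sigma_preimage cVcoord (F i)) ->
  g_sigma_preimage cVcoord (\bigcup_i (F i)).
Proof. exact: sigma_algebra_bigcup. Qed.

HB.instance Definition _ :=
  @isMeasurable.Build measure_cV_display 'cV[R]_n
    (g_sigma_preimage cVcoord) cV_set0 cV_setC cV_bigcup.

End measurable_cV.

Section measurable_cV_theory.
Variable R : realType.

Lemma measurable_cVcoord n (i : 'I_n) :
  measurable_fun [set: 'cV[R]_n] (@cVcoord R n i).
Proof.
move=> _ Y mY; rewrite setTI; apply: sub_sigma_algebra => /=.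
rewrite -bigcup_seq/=; exists i => /=; first by rewrite mem_index_enum.
by exists Y => //; rewrite setTI.
Qed.

Lemma measurable_fun_cVP d (T : measurableType d) n (f : T -> 'cV[R]_n) :
  (forall i, measurable_fun [set: T] (fun x => cVcoord i (f x))) ->
  measurable_fun [set: T] f.
Proof.
move=> mf _ A mA; rewrite setTI.
suff : g_sigma_preimage (fun i => @cVcoord R n i \o f) `<=` measurable.
  by apply; rewrite g_sigma_preimage_comp; exists A => //; rewrite setTI.
apply: smallest_sub; first exact: sigma_algebra_measurable.
rewrite -bigcup_seq => C [i _] [B mB <-].
by apply: mf.
Qed.

End measurable_cV_theory.

Section lebesgue_cV.
Variable R : realType.

(* (s, x) |-> (s, x_0, ..., x_(n-1)) *)
Definition cV_cons n (z : measurableTypeR R * 'cV[R]_n) : 'cV[R]_n.+1 :=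
  \col_i (if unlift ord0 i is Some j then z.2 j 0 else z.1).

Definition cV_uncons n (x : 'cV[R]_n.+1) : measurableTypeR R * 'cV[R]_n :=
  (cVcoord ord0 x, \col_i x (lift ord0 i) 0).

Lemma cV_cons0 n z : cVcoord ord0 (@cV_cons n z) = z.1.
Proof. by rewrite /cVcoord mxE unlift_none. Qed.

Lemma cV_consS n z i : cVcoord (lift ord0 i) (@cV_cons n z) = z.2 i 0.
Proof. by rewrite /cVcoord mxE liftK. Qed.

Lemma cV_unconsK n : cancel (@cV_uncons n) (@cV_cons n).
Proof.
move=> x; apply/colP => i; rewrite mxE.
by case: (unliftP ord0 i) => [j|] -> //=; rewrite mxE.
Qed.

Lemma cV_consK n : cancel (@cV_cons n) (@cV_uncons n).
Proof.
move=> [s x]; rewrite /cV_uncons cV_cons0 /=; congr pair.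
by apply/colP => i; rewrite mxE; have := @cV_consS n (s, x) i.
Qed.

Lemma measurable_cV_cons n : measurable_fun setT (@cV_cons n).
Proof.
apply: measurable_fun_cVP => i.
case: (unliftP ord0 i) => [j|] ->.
  rewrite (_ : (fun _ => _) = @cVcoord R n j \o snd).
    by apply: measurableT_comp => //; exact: measurable_cVcoord.
  by apply/funext => z; rewrite cV_consS.
rewrite (_ : (fun _ => _) = fst) //.
by apply/funext => z; rewrite cV_cons0.
Qed.

Lemma measurable_cV_uncons n : measurable_fun setT (@cV_uncons n).
Proof.
apply/measurable_fun_pairP; split; first exact: measurable_cVcoord.
apply: measurable_fun_cVP => i.
rewrite (_ : (fun _ => _) = @cVcoord R n.+1 (lift ord0 i)).
  exact: measurable_cVcoord.
by apply/funext => x; rewrite /cVcoord /= mxE.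
Qed.

Section lebesgue_cV_step.
Variables (n : nat) (mu : {sigma_finite_measure set 'cV[R]_n -> \bar R}).

Definition lebesgue_cVS : set 'cV[R]_n.+1 -> \bar R :=
  pushforward (@lebesgue_measure R \x mu)%E (@cV_cons n).

Let lebesgue_cVS0 : lebesgue_cVS set0 = 0%E.
Proof. by rewrite /lebesgue_cVS /pushforward preimage_set0 measure0. Qed.

Let lebesgue_cVS_ge0 A : (0 <= lebesgue_cVS A)%E.
Proof. by rewrite /lebesgue_cVS /pushforward measure_ge0. Qed.

Let lebesgue_cVS_sigma_additive : semi_sigma_additive lebesgue_cVS.
Proof.
have mc A : measurable A -> measurable (@cV_cons n @^-1` A).
  by move=> mA; rewrite -[X in measurable X]setTI; exact: measurable_cV_cons.
move=> F mF tF mUF; rewrite /lebesgue_cVS /pushforward preimage_bigcup.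
apply: measure_semi_sigma_additive => [k||]; first exact: mc.
- apply/trivIsetP => i j _ _ ij; rewrite -preimage_setI.
  by move/trivIsetP : tF => /(_ _ _ _ _ ij) ->//; rewrite preimage_set0.
- by rewrite -preimage_bigcup; exact: mc.
Qed.

HB.instance Definition _ := isMeasure.Build _ _ _ lebesgue_cVS
  lebesgue_cVS0 lebesgue_cVS_ge0 lebesgue_cVS_sigma_additive.

Let sigma_finite_lebesgue_cVS : sigma_finite setT lebesgue_cVS.
Proof.
have /sigma_finiteP[F [TF ndF Foo]] :=
  sigma_finiteT (@lebesgue_measure R : {sigma_finite_measure set _ -> \bar R}).
have /sigma_finiteP[G [TG ndG Goo]] := sigma_finiteT mu.
exists (fun k => @cV_uncons n @^-1` (F k `*` G k)).
  rewrite -preimage_bigcup (_ : \bigcup_k _ = setT) ?preimage_setT //.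
  apply/seteqP; split => // -[x y] _.
  have [k _ Fkx] : (\bigcup_k F k) x by rewrite -TF.
  have [l _ Gly] : (\bigcup_k G k) y by rewrite -TG.
  exists (maxn k l) => //; split.
    by move: x Fkx; exact/subsetPset/ndF/leq_maxl.
  by move: y Gly; exact/subsetPset/ndG/leq_maxr.
move=> k; have [mF Fk] := Foo k; have [mG Gk] := Goo k; split.
  rewrite -[X in measurable X]setTI.
  by apply: measurable_cV_uncons => //; exact: measurableX.
rewrite /lebesgue_cVS /pushforward -comp_preimage (_ : _ \o _ = id); last first.
  by apply/funext => z; rewrite /= cV_consK.
by rewrite preimage_id product_measure1E// lte_mul_pinfty// ge0_fin_numE.
Qed.

HB.instance Definition _ := Measure_isSigmaFinite.Build _ _ _ lebesgue_cVS
  sigma_finite_lebesgue_cVS.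

End lebesgue_cV_step.

(* Lebesgue measure on R^n. R^0 is a point, of mass 1; on R^(n+1) it is the
   product of the measures on R and R^n, transported by cV_cons. *)
Fixpoint lebesgue_cV n : {sigma_finite_measure set 'cV[R]_n -> \bar R} :=
  match n with
  | 0 => \d_(0 : 'cV[R]_0)
  | m.+1 => lebesgue_cVS (lebesgue_cV m)
  end.

End lebesgue_cV.
Arguments lebesgue_cV {R n}.

Section matrices.
Variables (R : realType) (n : nat).
Implicit Types (A Q B : 'M[R]_n) (x y : 'cV[R]_n).

Definition dotcV x y : R := \sum_i x i 0 * y i 0.

Definition posdefmx Q : Prop := forall x, x != 0 -> 0 < dotcV (Q *m x) x.

Definition neg_spectrum B : Prop := forall z : R[i],
  eigenvalue (map_mx (real_complex R) B) z -> complex.Re z < 0.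

Definition expmx A : 'M[R]_n := limn (series (fun k => k`!%:R^-1 *: A ^+ k)).

End matrices.

Section gaussian.
Variables (R : realType) (n : nat).
Implicit Types (S : 'M[R]_n) (x : 'cV[R]_n).

Definition gauss_pdf S x : R :=
  (2 * pi) `^ (- (n%:R / 2)) * (\det S) `^ (- 2^-1) *
  expR (- 2^-1 * dotcV (invmx S *m x) x).

Lemma gauss_pdf_ge0 S x : 0 <= gauss_pdf S x.
Proof. by rewrite !mulr_ge0 ?powR_ge0 ?expR_ge0. Qed.

Lemma measurable_gauss_pdf S : measurable_fun setT (gauss_pdf S).
Proof.
have mc i : measurable_fun setT (fun x : 'cV[R]_n => x i 0 : R).
  exact: measurable_cVcoord.
apply: measurable_funM => //; apply: measurableT_comp => //.
apply: measurable_funM => //; apply: measurable_sum => i.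
apply: measurable_funM => //.
rewrite (_ : (fun _ => _) = (fun x => \sum_j invmx S i j * x j 0)).
  by apply: measurable_sum => j; exact: measurable_funM.
by apply/funext => x; rewrite mxE.
Qed.

Definition gauss_measure S : set 'cV[R]_n -> \bar R :=
  fun A => (\int[lebesgue_cV]_(x in A) (gauss_pdf S x)%:E)%E.

Let gauss_measure0 S : gauss_measure S set0 = 0%E.
Proof. exact: integral_set0. Qed.

Let gauss_measure_ge0 S A : (0 <= gauss_measure S A)%E.
Proof. by apply: integral_ge0 => x _; rewrite lee_fin gauss_pdf_ge0. Qed.

Let gauss_measure_sigma_additive S : semi_sigma_additive (gauss_measure S).
Proof.
move=> F mF tF mUF; rewrite /gauss_measure ge0_integral_bigcup//=; last 2 first.
- apply/measurable_EFinP/measurable_funTS; exact: measurable_gauss_pdf.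
- by move=> x _; rewrite lee_fin gauss_pdf_ge0.
apply: is_cvg_ereal_nneg_natsum_cond => k _ _.
by apply: integral_ge0 => x _; rewrite lee_fin gauss_pdf_ge0.
Qed.

HB.instance Definition _ S := isMeasure.Build _ _ _ (gauss_measure S)
  (gauss_measure0 S) (gauss_measure_ge0 S) (@gauss_measure_sigma_additive S).

End gaussian.

Section ornstein_uhlenbeck.
Variables (R : realType) (n : nat) (Q B : 'M[R]_n).

(* The matrix Q_t, the integral being taken entrywise. *)
Definition OU_cov (t : \bar R) : 'M[R]_n :=
  \matrix_(i, j) \int[lebesgue_measure]_(s in [set s : R | (0 <= s%:E <= t)%E])
    (expmx (s *: B) *m Q *m expmx (s *: B^T)) i j.

Definition OU_gauss (t : \bar R) : {measure set 'cV[R]_n -> \bar R} :=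
  gauss_measure (OU_cov t).

Definition OU_semigroup (t : R) (f : 'cV[R]_n -> R) (x : 'cV[R]_n) : R :=
  \int[OU_gauss t%:E]_y f (expmx (t *: B) *m x - y).

End ornstein_uhlenbeck.

(* The variation seminorm of order rho of g over I, possibly infinite. *)
Definition variation_seminorm (R : realType) (rho : R) (I : set R)
    (g : R -> R) : \bar R :=
  ereal_sup [set v | exists (N : nat) (t : nat -> R),
    [/\ (0 < N)%N,
        forall i, (i < N)%N -> t i < t i.+1,
        forall i, (i <= N)%N -> I (t i) &
        v = ((\sum_(1 <= i < N.+1) `|g (t i) - g (t i.-1)| `^ rho)
               `^ rho^-1)%:E]].

(* Main.v *)
Require Import Defs.
From mathcomp Require Import all_boot all_order all_algebra.
From mathcomp Require Import perm complex.
From mathcomp Require Import all_classical all_reals all_analysis measurable_realfun.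
From mathcomp Require Import ring lra.

Set Implicit Arguments.
Unset Strict Implicit.
Unset Printing Implicit Defensive.

Import Order.TTheory GRing.Theory Num.Theory.
Import numFieldNormedType.Exports.

Local Open Scope classical_set_scope.
Local Open Scope ring_scope.

(* The estimate is pointwise in x. Write N x = <Q_oo^-1 x, x> and let k_t(x, u) be the
   Lebesgue kernel of H_t, a Gaussian density with mean e^(tB) x and covariance Q_t.
   From Q_t = Q_oo - e^(tB) Q_oo e^(tB)^T and Q_t >= l Q_oo for t >= 1, with l > 0, one gets
   numbers b < 1/p < a with
     <Q_t^-1 (e^(tB) x - u), e^(tB) x - u> >= a N u - b N x,
   and since e^(tB) decays exponentially, after a small change of a and b,
     |k_t - k_s| <= K (e^(-cs) - e^(-ct)) e^((b N x - a N u) / 2)      (1 <= s <= t).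
   The right-hand side telescopes, so the variation of order 1, which dominates those of
   order rho, is at most K e^(b N x / 2) times the integral of |f| e^(-a N / 2). As
   a > 1/p, Hoelder's inequality bounds that integral by the L^p(gamma_oo) norm of f, and
   as b < 1/p, e^(b N / 2) is in L^p(gamma_oo). *)

(** * Lebesgue and Gaussian measures on column vectors *)

(** Both strict inequalities [b < 1/p < a] serve integrability. Let [q] be the conjugate exponent of
    [p]. Under [gamma_oo], the functions left at the end are [e^(p b N / 2)] and
    [e^(q (1 - a) N / 2)], and they call for [p b < 1] and [q (1 - a) < 1]. The gap is also spent on
    the factor [1 + |x|^2 + |u|^2] that differences of kernels produce. The kernel is never
    differentiated in [t]. By the formula for [Q_t], its covariance depends on [t] only through
    [e^(tB)]. Lipschitz estimates for inverses, determinants and exponentials then carry a bound on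
    [e^(tB) - e^(sB)] over to the kernel. They are uniform because [t >= 1] keeps [Q_t] away from
    singular matrices. No spectral decomposition is used: the facts on positive definite matrices
    come from expanding well-chosen squares, and the decay of [e^(tB)] comes from an energy estimate
    together with Cayley-Hamilton. *)

Lemma ex_pushforward d d' (T1 : measurableType d) (T2 : measurableType d')
    (R : realFieldType) (m : {measure set T1 -> \bar R}) (f : T1 -> T2) :
  measurable_fun setT f ->
  exists nu : {measure set T2 -> \bar R}, forall A, nu A = m (f @^-1` A).
Proof. by move=> mf; unshelve eexists (pushforward m f). Qed.

(** Here [nu] is any measure that agrees with the image of [mu] on measurable sets. With [nu = mu]
    this gives invariance under reflections; with [phi = cV_cons] it unfolds Lebesgue measure by one
    dimension. *)
Lemma ge0_integral_preimage d d' (T1 : measurableType d) (T2 : measurableType d')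
    (R : realType) (mu : {measure set T1 -> \bar R}) (nu : {measure set T2 -> \bar R})
    (phi : T1 -> T2) (f : T2 -> \bar R) :
  measurable_fun setT phi ->
  (forall A, measurable A -> nu A = mu (phi @^-1` A)) ->
  measurable_fun setT f -> (forall x, 0 <= f x)%E ->
  (\int[nu]_x f x = \int[mu]_x f (phi x))%E.
Proof.
move=> mphi nuE mf f0.
have := @ge0_integral_pushforward _ _ _ _ R _ mphi mu setT f measurableT mf.
rewrite preimage_setT => <- //.
have [nu' nu'E] := ex_pushforward mu mphi.
rewrite (_ : pushforward mu phi = nu'); last by apply/funext => A; rewrite nu'E.
by apply: eq_measure_integral => A mA _; rewrite nuE// nu'E.
Qed.

Lemma integral_preimage d d' (T1 : measurableType d) (T2 : measurableType d')
    (R : realType) (mu : {measure set T1 -> \bar R}) (nu : {measure set T2 -> \bar R})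
    (phi : T1 -> T2) (f : T2 -> \bar R) :
  measurable_fun setT phi ->
  (forall A, measurable A -> nu A = mu (phi @^-1` A)) ->
  measurable_fun setT f ->
  (\int[nu]_x f x = \int[mu]_x f (phi x))%E.
Proof.
move=> mphi nuE mf; rewrite integralE [RHS]integralE.
congr (_ - _)%E.
  rewrite (_ : (fun x => f (phi x))^\+ = f^\+ \o phi)%E; last exact: funepos_comp.
  by rewrite (ge0_integral_preimage mphi nuE (measurable_funepos mf)).
rewrite (_ : (fun x => f (phi x))^\- = f^\- \o phi)%E; last exact: funeneg_comp.
by rewrite (ge0_integral_preimage mphi nuE (measurable_funeneg mf)).
Qed.

(** Reflections are the substitution that the semigroup needs, since it integrates
    [f (e^(tB) x - y)] in [y]. The preimage of []x, y]] is [[a - y, a - x[], of the same length, so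
    uniqueness of Lebesgue measure applies. *)
Lemma lebesgue_measure_reflection (R : realType) (a : R)
    (A : set (measurableTypeR R)) : measurable A ->
  lebesgue_measure ((fun s : measurableTypeR R => a - s : measurableTypeR R) @^-1` A)
  = lebesgue_measure A.
Proof.
have mphi : measurable_fun setT
    (fun s : measurableTypeR R => a - s : measurableTypeR R).
  exact: measurable_funB.
have [nu nuE] := ex_pushforward lebesgue_measure mphi.
move=> mA; rewrite -nuE; apply/esym; apply: lebesgue_measure_unique => // _ [[x y]] _ <-.
rewrite nuE.
have -> : (fun s : measurableTypeR R => a - s) @^-1` `]x, y] =
    [set` `[a - y, a - x[] :> set R.
  by apply/seteqP; split => s /=; rewrite !in_itv/=; lra.
rewrite lebesgue_measure_itv [RHS]lebesgue_measure_itv/= !lte_fin ltrD2l ltrN2.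
by case: ifP => //; rewrite -!EFinD => _; congr EFin; ring.
Qed.

(** A translation is the composite of two reflections. *)
Lemma integral_translation (R : realType) (a : R) (f : measurableTypeR R -> \bar R) :
  measurable_fun setT f ->
  (\int[lebesgue_measure]_x f x = \int[lebesgue_measure]_x f (a + x)%R)%E.
Proof.
have mrefl (b : R) : measurable_fun setT
    (fun s : measurableTypeR R => b - s : measurableTypeR R).
  exact: measurable_funB.
have refl (b : R) (g : measurableTypeR R -> \bar R) : measurable_fun setT g ->
    (\int[lebesgue_measure]_x g x = \int[lebesgue_measure]_x g (b - x)%R)%E.
  move=> mg; apply: (integral_preimage (mrefl b)) => // A mA.
  exact/esym/lebesgue_measure_reflection.
move=> mf; rewrite (refl a) // (refl 0); last exact: (measurableT_comp mf (mrefl a)).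
by apply: eq_integral => x _; rewrite sub0r opprK.
Qed.

Lemma measurable_reflection_cV (R : realType) n (a : 'cV[R]_n) :
  measurable_fun setT (fun x : 'cV[R]_n => a - x : 'cV[R]_n).
Proof.
apply: measurable_fun_cVP => i.
rewrite (_ : (fun x => _) = (fun x : 'cV[R]_n => a i 0 - cVcoord i x)).
  by apply: measurable_funB => //; exact: measurable_cVcoord.
by apply/funext => x; rewrite /cVcoord !mxE.
Qed.

(** Induction on the dimension: a reflection acts on each coordinate separately, and a product
    measure is determined by its values on rectangles. *)
Lemma lebesgue_cV_reflection (R : realType) n (a : 'cV[R]_n) (A : set 'cV[R]_n) :
  measurable A -> lebesgue_cV ((fun x => a - x) @^-1` A) = lebesgue_cV A.
Proof.
elim: n a A => [|n IH] a A mA.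
  rewrite (_ : _ @^-1` _ = A)//; apply: eq_set => x.
  by rewrite [a - x]flatmx0 [x]flatmx0.
rewrite /= /lebesgue_cVS /pushforward.
pose a0 : R := a ord0 0.
pose a1 : 'cV[R]_n := \col_i a (lift ord0 i) 0.
pose refl (z : measurableTypeR R * 'cV[R]_n) :
  measurableTypeR R * 'cV[R]_n := (a0 - z.1, a1 - z.2).
have mrefl : measurable_fun setT refl.
  apply/measurable_fun_pairP; split; first exact: measurable_funB.
  exact: (measurableT_comp (measurable_reflection_cV a1) (@measurable_snd _ _ _ _)).
have -> : @cV_cons R n @^-1` ((fun x => a - x) @^-1` A) =
          refl @^-1` (@cV_cons R n @^-1` A).
  apply/seteqP; split => z /=; rewrite (_ : a - cV_cons z = cV_cons (refl z)) //;
  by apply/colP => i; rewrite !mxE; case: (unliftP ord0 i) => [j|] -> //=; rewrite !mxE.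
have [nu nuE] := ex_pushforward (@lebesgue_measure R \x (@lebesgue_cV R n))%E mrefl.
have mcA : measurable (@cV_cons R n @^-1` A).
  by rewrite -[X in measurable X]setTI; exact: measurable_cV_cons.
rewrite -nuE; apply/esym; apply: product_measure_unique => // B C mB mC.
rewrite nuE.
rewrite (_ : _ @^-1` _ = ((fun s => a0 - s) @^-1` B) `*` ((fun s => a1 - s) @^-1` C)) //.
apply: (eq_trans (product_measure1E _ _ _ _)).
- by rewrite -[X in measurable X]setTI; apply: measurable_funB.
- by rewrite -[X in measurable X]setTI; apply: measurable_reflection_cV.
- by rewrite [X in (X * _)%E]lebesgue_measure_reflection // IH.
Qed.

Lemma integral_cV_reflection (R : realType) n (a : 'cV[R]_n)
    (f : 'cV[R]_n -> \bar R) : measurable_fun setT f ->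
  (\int[lebesgue_cV]_x f (a - x)%R = \int[lebesgue_cV]_x f x)%E.
Proof.
move=> mf; apply/esym; apply: integral_preimage => //.
  exact: measurable_reflection_cV.
by move=> A mA; exact/esym/lebesgue_cV_reflection.
Qed.

(** * Integration against a measure with a density *)

Section density.
Context d (T : measurableType d) (R : realType).
Variables (mu nu : {measure set T -> \bar R}) (g : T -> R).
Hypotheses (mg : measurable_fun setT g) (g0 : forall x, 0 <= g x).
Hypothesis nuE : forall A, measurable A -> (nu A = \int[mu]_(x in A) (g x)%:E)%E.
Local Open Scope ereal_scope.
Import HBNNSimple.

(** Monotone convergence reduces to simple functions, linearity to indicators, and for an indicator
    the identity is [nuE]. *)
Lemma ge0_integral_density (f : T -> \bar R) :
  measurable_fun setT f -> (forall x, 0 <= f x) ->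
  \int[nu]_x f x = \int[mu]_x (f x * (g x)%:E).
Proof.
move=> mf f0; have mgE : measurable_fun setT (EFin \o g) by exact/measurable_EFinP.
pose h := nnsfun_approx measurableT mf.
have -> : \int[nu]_x f x = lim (\int[nu]_x (EFin \o h n) x @[n --> \oo]).
  rewrite -monotone_convergence//.
  - apply: eq_integral => x _; apply/esym/cvg_lim => //.
    by apply: cvg_nnsfun_approx => // *; exact: f0.
  - by move=> n; exact/measurable_EFinP.
  - by move=> n x _; rewrite lee_fin.
  - by move=> x _ a b ab; rewrite lee_fin; exact/lefP/nd_nnsfun_approx.
have -> : \int[mu]_x (f x * (g x)%:E) =
    lim (\int[mu]_x ((EFin \o h n) x * (g x)%:E) @[n --> \oo]).
  rewrite -monotone_convergence//.
  - apply: eq_integral => x _; apply/esym/cvg_lim => //.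
    by apply: cvgeZr => //; apply: cvg_nnsfun_approx => // *; exact: f0.
  - by move=> n; apply: emeasurable_funM => //; exact/measurable_EFinP.
  - by move=> n x _; rewrite mule_ge0// lee_fin.
  - move=> x _ a b ab; rewrite lee_wpmul2r ?lee_fin//.
    exact/lefP/nd_nnsfun_approx.
congr (lim (_ @ \oo)); apply/funext => n.
transitivity (\int[nu]_x
   (\sum_(y \in range (h n)) (y * \1_(h n @^-1` [set y]) x)%:E)).
  by apply: eq_integral => t tE; rewrite /= fimfunE -fsumEFin.
have indich r : measurable_fun setT (fun x => (r * \1_(h n @^-1` [set r]) x)%:E).
  by apply/measurable_EFinP; exact: measurable_funM.
rewrite ge0_integral_fsum//; last by move=> m y Ey; exact: nnfun_muleindic_ge0.
transitivity (\int[mu]_x (\sum_(y \in range (h n))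
    (y * \1_(h n @^-1` [set y]) x)%:E * (g x)%:E)); last first.
  apply: eq_integral => x _.
  rewrite -ge0_mule_fsuml => [|y]; last exact: nnfun_muleindic_ge0.
  by rewrite fsumEFin // -(fimfunE _ x).
rewrite ge0_integral_fsum//; last 2 first.
  - by move=> y; apply: emeasurable_funM.
  - move=> m y Ey; apply: mule_ge0; last by rewrite lee_fin.
    exact: nnfun_muleindic_ge0.
apply: eq_fsbigr => r; rewrite inE => -[x _ hxr].
under eq_integral do rewrite EFinM.
rewrite integralZl_indic_nnsfun => //.
under [RHS]eq_integral do rewrite EFinM -muleA.
rewrite ge0_integralZl//.
- rewrite integral_indic// setIT nuE// integral_mkcond; congr (_ * _).
  by apply: eq_integral => y _; rewrite muleC epatch_indic.
- by apply: emeasurable_funM => //; exact/measurable_EFinP.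
- by move=> y _; rewrite mule_ge0// lee_fin.
- by rewrite -hxr lee_fin.
Qed.

Lemma integral_density (f : T -> \bar R) : measurable_fun setT f ->
  \int[nu]_x f x = \int[mu]_x (f x * (g x)%:E).
Proof.
move=> mf; rewrite integralE [RHS]integralE.
rewrite (ge0_integral_density (measurable_funepos mf))//.
rewrite (ge0_integral_density (measurable_funeneg mf))//.
congr (_ - _); apply: eq_integral => x _.
  by rewrite !funeposE maxe_pMl ?lee_fin// mul0e.
by rewrite !funenegE maxe_pMl ?lee_fin// mul0e mulNe.
Qed.

End density.

Lemma integral_gauss_measure (R : realType) n (S : 'M[R]_n) (f : 'cV[R]_n -> \bar R) :
  measurable_fun setT f ->
  (\int[gauss_measure S]_x f x = \int[lebesgue_cV]_x (f x * (gauss_pdf S x)%:E))%E.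
Proof.
by apply: integral_density => //; [exact: measurable_gauss_pdf|exact: gauss_pdf_ge0].
Qed.

Lemma measurable_cV_entry (R : realType) n (i : 'I_n) :
  measurable_fun [set: 'cV[R]_n] (fun x => x i 0 : R).
Proof. exact: measurable_cVcoord. Qed.

Lemma measurable_dotcVv (R : realType) n :
  measurable_fun [set: 'cV[R]_n] (fun x => dotcV x x).
Proof.
by apply: measurable_sum => i; apply: measurable_funM; exact: measurable_cV_entry.
Qed.

Lemma integral_expR_sqr_lty (R : realType) (e : R) : 0 < e ->
  (\int[lebesgue_measure]_s (expR (- (e * s ^+ 2)))%:E < +oo)%E.
Proof.
(* The integrand is the centred normal density of variance [(2 e)^-1] divided by its peak. *)
move=> e0; pose s : R := Num.sqrt (2 * e)^-1.
have s0 : s != 0 by rewrite gt_eqF// sqrtr_gt0 invr_gt0 mulr_gt0.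
have sE : s ^+ 2 = (2 * e)^-1 by rewrite sqr_sqrtr// invr_ge0 mulr_ge0// ltW.
have pk0 := normal_peak_gt0 s0.
rewrite (eq_integral (fun x : measurableTypeR R =>
    (normal_peak s)^-1%:E * (normal_pdf 0 s x)%:E)%E).
  rewrite ge0_integralZl//.
  - by rewrite integral_normal_pdf mule1 ltry.
  - by apply/measurable_EFinP; exact: measurable_normal_pdf.
  - by move=> x _; rewrite lee_fin normal_pdf_ge0.
  - by rewrite lee_fin invr_ge0 ltW.
move=> x _; rewrite -EFinM normal_pdfE// mulKf ?gt_eqF//.
rewrite /normal_fun subr0 sE; congr (expR _)%:E.
by field; rewrite gt_eqF.
Qed.

(** By Tonelli the integral in dimension [n + 1] is the one in dimension [n] times a one-dimensional
    Gaussian integral. *)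
Lemma integral_cV_expR_dotcV_lty (R : realType) n (e : R) : 0 < e ->
  (\int[@lebesgue_cV R n]_x (expR (- (e * dotcV x x)))%:E < +oo)%E.
Proof.
move=> e0.
have mE m : measurable_fun [set: 'cV[R]_m] (fun x => (expR (- (e * dotcV x x)))%:E).
  apply/measurable_EFinP; apply: measurableT_comp => //; apply: measurableT_comp => //.
  by apply: measurable_funM => //; exact: measurable_dotcVv.
elim: n => [|n IH].
  rewrite [X in (X < _)%E](_ : _ = \int[@lebesgue_cV R 0]_x (cst 1%:E) x)%E; last first.
    by apply: eq_integral => x _; rewrite /dotcV big_ord0 mulr0 oppr0 expR0.
  by rewrite integral_cst//= diracT mul1e ltry.
rewrite (@ge0_integral_preimage _ _ _ _ _ (@lebesgue_measure R \x @lebesgue_cV R n)%E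
  _ (@cV_cons R n)) //; last 2 first.
- exact: measurable_cV_cons.
- exact: mE.
rewrite fubini_tonelli1//=; last exact: (measurableT_comp (mE n.+1) (@measurable_cV_cons R n)).
set J := (\int[lebesgue_cV]_x _)%E in IH.
have J0 : (0 <= J)%E by apply: integral_ge0 => x _; rewrite lee_fin expR_ge0.
rewrite (eq_integral (fun s : measurableTypeR R => J * (expR (- (e * s ^+ 2)))%:E)%E).
  rewrite ge0_integralZl//.
  - by rewrite lte_mul_pinfty ?ge0_fin_numE// integral_expR_sqr_lty.
  - apply/measurable_EFinP; apply: measurableT_comp => //; apply: measurableT_comp => //.
    by apply: measurable_funM => //; exact: measurable_funX.
move=> s _; rewrite /fubini_F muleC -ge0_integralZl//.
- apply: eq_integral => v _; rewrite -EFinM -expRD /dotcV big_ord_recl; congr (expR _)%:E.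
  rewrite -opprD -mulrDr; congr (- (e * (_ + _))).
    by rewrite !mxE unlift_none expr2.
  by apply: eq_bigr => i _; rewrite !mxE liftK.
- exact: mE.
Qed.

(** * Positive definite matrices *)

Section mxnorm1.
Variable R : realType.
Implicit Types m n p : nat.

(** This norm is submultiplicative and invariant under transposition, and it controls entries,
    quadratic forms and determinants, so it serves for all matrix estimates below. *)
Definition mxnorm1 m n (A : 'M[R]_(m, n)) : R := \sum_i \sum_j `|A i j|.

Lemma mxnorm1_ge0 m n (A : 'M[R]_(m, n)) : 0 <= mxnorm1 A.
Proof. by apply: sumr_ge0 => i _; apply: sumr_ge0. Qed.

Lemma ler_entry_mxnorm1 m n (A : 'M[R]_(m, n)) i j : `|A i j| <= mxnorm1 A.
Proof.
rewrite /mxnorm1 (bigD1 i)//= (bigD1 j)//= -addrA lerDl addr_ge0//.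
  exact: sumr_ge0.
by apply: sumr_ge0 => k _; exact: sumr_ge0.
Qed.

Lemma mxnorm1_le m n (A : 'M[R]_(m, n)) K :
  (forall i j, `|A i j| <= K) -> mxnorm1 A <= m%:R * (n%:R * K).
Proof.
move=> AK; rewrite /mxnorm1.
apply: (@le_trans _ _ (\sum_(i < m) \sum_(j < n) K)).
  by apply: ler_sum => i _; apply: ler_sum => j _.
by rewrite !sumr_const !card_ord !mulr_natl.
Qed.

Lemma ler_mxnorm1D m n (A B : 'M[R]_(m, n)) :
  mxnorm1 (A + B) <= mxnorm1 A + mxnorm1 B.
Proof.
rewrite /mxnorm1 -big_split; apply: ler_sum => i _ /=.
by rewrite -big_split; apply: ler_sum => j _ /=; rewrite mxE ler_normD.
Qed.

Lemma mxnorm1N m n (A : 'M[R]_(m, n)) : mxnorm1 (- A) = mxnorm1 A.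
Proof. by apply: eq_bigr => i _; apply: eq_bigr => j _; rewrite mxE normrN. Qed.

Lemma mxnorm1B m n (A B : 'M[R]_(m, n)) : mxnorm1 (A - B) = mxnorm1 (B - A).
Proof. by rewrite -mxnorm1N opprB. Qed.

Lemma mxnorm1_tr m n (A : 'M[R]_(m, n)) : mxnorm1 A^T = mxnorm1 A.
Proof.
by rewrite /mxnorm1 exchange_big; apply: eq_bigr => i _; apply: eq_bigr => j _; rewrite mxE.
Qed.

Lemma ler_mxnorm1M m n p (A : 'M[R]_(m, n)) (B : 'M[R]_(n, p)) :
  mxnorm1 (A *m B) <= mxnorm1 A * mxnorm1 B.
Proof.
rewrite /mxnorm1 mulr_suml; apply: ler_sum => i _.
apply: (@le_trans _ _ (\sum_j \sum_k `|A i k| * `|B k j|)).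
  apply: ler_sum => j _; rewrite mxE (le_trans (ler_norm_sum _ _ _))//.
  by apply: ler_sum => k _; rewrite normrM.
rewrite exchange_big mulr_suml /=; apply: ler_sum => k _.
rewrite -mulr_sumr ler_wpM2l//.
by rewrite [leRHS](bigD1 k)//= lerDl; apply: sumr_ge0 => l _; apply: sumr_ge0.
Qed.

End mxnorm1.

Section dotcV.
Variables (R : realType) (n : nat).
Implicit Types (A S T : 'M[R]_n) (x y z w : 'cV[R]_n).

Lemma dotcVC x y : dotcV x y = dotcV y x.
Proof. by apply: eq_bigr => i _; rewrite mulrC. Qed.

Lemma dotcVDl x y z : dotcV (x + y) z = dotcV x z + dotcV y z.
Proof. by rewrite /dotcV -big_split; apply: eq_bigr => i _; rewrite mxE mulrDl. Qed.

Lemma dotcVNl x y : dotcV (- x) y = - dotcV x y.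
Proof. by rewrite /dotcV -sumrN; apply: eq_bigr => i _; rewrite mxE mulNr. Qed.

Lemma dotcVZl a x y : dotcV (a *: x) y = a * dotcV x y.
Proof. by rewrite /dotcV mulr_sumr; apply: eq_bigr => i _; rewrite mxE mulrA. Qed.

Lemma dotcVBl x y z : dotcV (x - y) z = dotcV x z - dotcV y z.
Proof. by rewrite dotcVDl dotcVNl. Qed.

Lemma dotcVDr x y z : dotcV z (x + y) = dotcV z x + dotcV z y.
Proof. by rewrite !(dotcVC z) dotcVDl. Qed.

Lemma dotcVNr x y : dotcV x (- y) = - dotcV x y.
Proof. by rewrite dotcVC dotcVNl dotcVC. Qed.

Lemma dotcVZr a x y : dotcV x (a *: y) = a * dotcV x y.
Proof. by rewrite dotcVC dotcVZl dotcVC. Qed.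

Lemma dotcVBr x y z : dotcV z (x - y) = dotcV z x - dotcV z y.
Proof. by rewrite dotcVDr dotcVNr. Qed.

Lemma dotcV_mx A x y : dotcV (A *m x) y = dotcV x (A^T *m y).
Proof.
have dotE u v : dotcV u v = (u^T *m v) 0 0.
  by rewrite mxE; apply: eq_bigr => i _; rewrite mxE.
by rewrite !dotE trmx_mul mulmxA.
Qed.

Lemma dotcV0l x : dotcV 0 x = 0.
Proof. by rewrite /dotcV big1// => i _; rewrite mxE mul0r. Qed.

Lemma dotcV_ge0 x : 0 <= dotcV x x.
Proof. by apply: sumr_ge0 => i _; rewrite -expr2 sqr_ge0. Qed.

Lemma sqr_entry_le_dotcV x i : x i 0 ^+ 2 <= dotcV x x.
Proof.
rewrite /dotcV (bigD1 i)//= expr2 lerDl; apply: sumr_ge0 => j _.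
by rewrite -expr2 sqr_ge0.
Qed.

Lemma dotcV_gt0 x : x != 0 -> 0 < dotcV x x.
Proof.
move=> x0; rewrite lt_neqAle dotcV_ge0 andbT eq_sym; apply: contra x0 => /eqP xx0.
apply/eqP/colP => i; rewrite mxE; apply/eqP; rewrite -(sqrf_eq0 (x i 0)).
by rewrite eq_le sqr_ge0 andbT -xx0 sqr_entry_le_dotcV.
Qed.

(** Each product satisfies [|x_j y_i| <= (x_j^2 + y_i^2) / 2], and the squares are at most [<x, x>]
    and [<y, y>]. *)
Lemma ler_norm_dotcV_mx A x y :
  `|dotcV (A *m x) y| <= mxnorm1 A * ((dotcV x x + dotcV y y) / 2).
Proof.
rewrite {1}/dotcV (le_trans (ler_norm_sum _ _ _))//.
rewrite /mxnorm1 mulr_suml; apply: ler_sum => i _.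
rewrite mxE normrM mulr_suml (le_trans (ler_wpM2r _ (ler_norm_sum _ _ _)))//.
rewrite mulr_suml; apply: ler_sum => j _.
rewrite normrM -mulrA ler_wpM2l// -normrM.
have := sqr_entry_le_dotcV x j; have := sqr_entry_le_dotcV y i.
move: (dotcV x x) (dotcV y y) => dx dy yi xj.
have := sqr_ge0 (x j 0 + y i 0); have := sqr_ge0 (x j 0 - y i 0).
by rewrite ler_norml; nra.
Qed.

Lemma dotcV_mx_sqr_le A x : dotcV (A *m x) (A *m x) <= mxnorm1 A ^+ 2 * dotcV x x.
Proof.
rewrite dotcV_mx mulmxA.
have := @ler_norm_dotcV_mx (A^T *m A) x x; rewrite dotcVC => /ler_normlW/le_trans; apply.
have -> : (dotcV x x + dotcV x x) / 2 = dotcV x x by field.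
rewrite ler_wpM2r ?dotcV_ge0// (le_trans (ler_mxnorm1M _ _))//.
by rewrite mxnorm1_tr expr2.
Qed.

Section posdef.
Variable S : 'M[R]_n.
Hypotheses (S_sym : S^T = S) (S_pos : posdefmx S).

Lemma posdefmx_unit : S \in unitmx.
Proof.
rewrite -row_free_unit; apply: inj_row_free => v vS0.
apply: trmx_inj; rewrite trmx0; apply/eqP; apply/negPn/negP => /S_pos.
by rewrite -{1}S_sym -trmx_mul vS0 trmx0 dotcV0l ltxx.
Qed.

Lemma posdefmx_ge0 x : 0 <= dotcV (S *m x) x.
Proof.
have [->|/S_pos/ltW//] := eqVneq x 0.
by rewrite mulmx0 dotcV0l.
Qed.

Lemma dotcV_sym x y : dotcV (S *m x) y = dotcV (S *m y) x.
Proof. by rewrite dotcV_mx S_sym dotcVC. Qed.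

Lemma invmx_sym : (invmx S)^T = invmx S.
Proof. by rewrite trmx_inv S_sym. Qed.

(* Legendre duality, with equality at [w = S^-1 z]. *)
Lemma invmx_quad_ge z w :
  2 * dotcV w z - dotcV (S *m w) w <= dotcV (invmx S *m z) z.
Proof.
set y := invmx S *m z; have zE : z = S *m y by rewrite mulKVmx// posdefmx_unit.
have := posdefmx_ge0 (y - w); rewrite {1}zE.
rewrite mulmxBr !dotcVBl !dotcVBr (dotcV_sym w y) zE (dotcVC w) (dotcVC y); lra.
Qed.

(** The form of [S] is nonnegative at [x - K^-1 S^-1 x]. Expanding gives [<S x, x> >= 2 K^-1 |x|^2 -
    K^-2 <S^-1 x, x>], and [<S^-1 x, x> <= K |x|^2]. *)
Lemma posdefmx_coercive K x : 0 < K -> mxnorm1 (invmx S) <= K ->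
  K^-1 * dotcV x x <= dotcV (S *m x) x.
Proof.
move=> K0 SK; have := posdefmx_ge0 (x - K^-1 *: (invmx S *m x)).
rewrite mulmxBr -scalemxAr mulKVmx ?posdefmx_unit//.
rewrite !dotcVBl !dotcVBr !dotcVZl !dotcVZr (dotcV_sym x (invmx S *m x)).
rewrite mulKVmx ?posdefmx_unit//.
have := @ler_norm_dotcV_mx (invmx S) x x; rewrite dotcVC => /ler_normlW.
have -> : (dotcV x x + dotcV x x) / 2 = dotcV x x by field.
move=> /le_trans/(_ (ler_wpM2r (dotcV_ge0 x) SK)).
set a := dotcV x (invmx S *m x); set b := dotcV x x; set c := dotcV _ x => ab.
have : K^-1 * (K^-1 * a) <= K^-1 * b.
  rewrite ler_pM2l ?invr_gt0// mulrC ler_pdivrMr//; lra.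
by lra.
Qed.

(** The j-th column [y] of [S^-1] solves [S y = e_j]. Coercivity, [c |y|^2 <= <e_j, y>], and
    [|e_j - c y|^2 >= 0] together give [c |y| <= 1], which bounds each of the [n^2] entries. *)
Lemma invmx_norm_le c : 0 < c -> (forall x, c * dotcV x x <= dotcV (S *m x) x) ->
  mxnorm1 (invmx S) <= n%:R * (n%:R * c^-1).
Proof.
move=> c0 cS; apply: mxnorm1_le => i j.
pose e : 'cV[R]_n := delta_mx j 0; pose y := invmx S *m e.
have ee : dotcV e e = 1.
  rewrite /dotcV (bigD1 j)//= !mxE !eqxx/= mulr1 big1 ?addr0// => k kj.
  by rewrite !mxE (negbTE kj) mul0r.
have -> : invmx S i j = y i 0 by rewrite /y -colE mxE.
have yE : S *m y = e by rewrite mulKVmx// posdefmx_unit.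
have := cS y; have := dotcV_ge0 (e - c *: y).
rewrite yE !dotcVBl !dotcVBr !dotcVZl !dotcVZr ee (dotcVC y) => h1 h2.
have h3 : (c * y i 0) ^+ 2 <= 1 ^+ 2.
  rewrite exprMn expr1n (le_trans (ler_wpM2l _ (sqr_entry_le_dotcV y i)))//; nra.
rewrite -[c^-1]mul1r ler_pdivlMr// -(ger0_norm (ltW c0)) -normrM mulrC.
by rewrite -(@ler_pXn2r _ 2)// ?nnegrE// real_normK// num_real.
Qed.

End posdef.

Lemma invmx_resolvent S T : S \in unitmx -> T \in unitmx ->
  invmx S - invmx T = invmx S *m (T - S) *m invmx T.
Proof.
by move=> uS uT; rewrite mulmxBr mulmxBl mulVmx// mul1mx -mulmxA mulmxV// mulmx1.
Qed.

(* The determinant does not vanish on the segment from the identity to [S]. *)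
Lemma posdefmx_det_gt0 S : S^T = S -> posdefmx S -> 0 < \det S.
Proof.
move=> S_sym S_pos; rewrite ltNge; apply/negP => dS.
pose L t : 'M[R]_n := (1 - t)%:M + t *: S.
(* The determinant along the segment is a polynomial in [t], so a change of sign between 0 and 1
   would produce a root by the intermediate value theorem for polynomials. *)
pose q : {poly R} := \det ((1 - 'X)%:M + 'X *: map_mx polyC S).
have qE t : q.[t] = \det (L t).
  rewrite -[LHS]/(horner_eval t q) -det_map_mx; congr determinant.
  apply/matrixP => i j; rewrite !mxE.
  rewrite -[LHS]/(((1 - 'X) *+ (i == j) + 'X * (S i j)%:P).[t]).
  by rewrite hornerD hornerMn !hornerE.
have : (- q).[0] <= 0 <= (- q).[1].
  rewrite !hornerN !qE /L subr0 scale0r addr0 det1 subrr scale1r.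
  by rewrite raddf0 add0r oppr_le0 ler01 oppr_ge0.
move=> /(poly_ivt ler01)[t /andP[t0 t1]].
rewrite rootN rootE qE.
suff : L t \in unitmx by rewrite unitmxE unitfE => /negbTE ->.
apply: posdefmx_unit.
  by rewrite /L linearD/= linearZ/= tr_scalar_mx S_sym.
move=> x x0; rewrite mulmxDl mul_scalar_mx -scalemxAl dotcVDl !dotcVZl.
have Sx := S_pos _ x0.
have xx := dotcV_gt0 x0.
have [->|tn0] := eqVneq t 0; first by rewrite subr0 mul1r mul0r addr0.
have : 0 < t by rewrite lt_neqAle eq_sym tn0.
nra.
Qed.

(** Factors are exchanged one at a time. The condition [1 <= K] allows every intermediate power of
    [K] to be raised to the full length. Applied to each term of the Leibniz formula, this gives the
    Lipschitz bound for determinants. *)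
Lemma prod_lipschitz (I : Type) (r : seq I) (a b : I -> R) K d : 1 <= K -> 0 <= d ->
  (forall i, `|a i| <= K) -> (forall i, `|b i| <= K) ->
  (forall i, `|a i - b i| <= d) ->
  `|\prod_(i <- r) a i - \prod_(i <- r) b i| <= (size r)%:R * (K ^+ size r * d).
Proof.
move=> K1 d0 aK bK abd.
have K0 : 0 <= K by rewrite (le_trans _ K1).
have pK (c : I -> R) (s : seq I) : (forall i, `|c i| <= K) ->
    `|\prod_(i <- s) c i| <= K ^+ size s.
  move=> cK; elim: s => [|i s IH]; first by rewrite big_nil normr1.
  by rewrite big_cons normrM exprS ler_pM.
elim: r => [|i r IH]; first by rewrite !big_nil subrr normr0 mul0r.
rewrite !big_cons /=.
set A := \prod_(j <- r) a j in IH *; set B := \prod_(j <- r) b j in IH *.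
have -> : a i * A - b i * B = a i * (A - B) + (a i - b i) * B by ring.
rewrite (le_trans (ler_normD _ _))// !normrM -natr1 mulrDl mul1r lerD//.
  rewrite exprS -mulrA [leRHS]mulrCA; exact: ler_pM.
rewrite mulrC ler_pM// (le_trans (pK _ _ bK))//.
by rewrite exprS ler_peMl// exprn_ge0.
Qed.

Lemma det_lipschitz S T K : 1 <= K -> mxnorm1 S <= K -> mxnorm1 T <= K ->
  `|\det S - \det T| <= (n`!)%:R * (n%:R * (K ^+ n * mxnorm1 (S - T))).
Proof.
move=> K1 SK TK; rewrite /determinant -sumrB (le_trans (ler_norm_sum _ _ _))//.
apply: (@le_trans _ _ (\sum_(s : 'S_n) n%:R * (K ^+ n * mxnorm1 (S - T)))).
  apply: ler_sum => s _; rewrite -mulrBr normrM normrX normrN1 expr1n mul1r.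
  have := @prod_lipschitz _ (index_enum 'I_n) (fun i => S i (s i)) (fun i => T i (s i))
    K (mxnorm1 (S - T)) K1 (mxnorm1_ge0 _).
  rewrite [index_enum _]unlock -enumT size_enum_ord; apply.
  - by move=> i; exact: le_trans (ler_entry_mxnorm1 _ _ _) SK.
  - by move=> i; exact: le_trans (ler_entry_mxnorm1 _ _ _) TK.
  - by move=> i; have := ler_entry_mxnorm1 (S - T) i (s i); rewrite !mxE.
by rewrite sumr_const card_Sn [leRHS]mulr_natl.
Qed.

Lemma det_norm_le S K : mxnorm1 S <= K -> `|\det S| <= (n`!)%:R * K ^+ n.
Proof.
move=> SK; rewrite /determinant (le_trans (ler_norm_sum _ _ _))//.
apply: (@le_trans _ _ (\sum_(s : 'S_n) K ^+ n)).
  apply: ler_sum => s _; rewrite normrM normrX normrN1 expr1n mul1r normr_prod.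
  have -> : K ^+ n = \prod_(i < n) K by rewrite prodr_const card_ord.
  apply: ler_prod => i _; rewrite normr_ge0/=.
  exact: le_trans (ler_entry_mxnorm1 _ _ _) SK.
by rewrite sumr_const card_Sn [leRHS]mulr_natl.
Qed.

End dotcV.

(** * The matrix exponential *)

Section real_derivatives.
Variable R : realType.
Implicit Types (f g : R -> R) (x : R).

Lemma is_derive1M f g x df dg : is_derive x 1 f df -> is_derive x 1 g dg ->
  is_derive x 1 (fun t => f t * g t) (df * g x + f x * dg).
Proof.
move=> hf hg; apply: is_derive_eq (is_deriveM hf hg) _.
by rewrite addrC /GRing.scale /= (mulrC (g x)).
Qed.

Lemma is_derive1_sum n (h : 'I_n -> R -> R) x (dh : 'I_n -> R) :
  (forall i, is_derive x 1 (h i) (dh i)) ->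
  is_derive x 1 (fun t => \sum_i h i t) (\sum_i dh i).
Proof.
move=> hd; have := is_derive_sum hd.
by rewrite (_ : \sum_i h i = fun t => \sum_i h i t)//; apply/funext => t; rewrite fct_sumE.
Qed.

Lemma is_derive1_mulmx m n p (F : R -> 'M[R]_(m, n)) (G : R -> 'M[R]_(n, p))
    (dF : 'M[R]_(m, n)) (dG : 'M[R]_(n, p)) x :
  (forall i j, is_derive x 1 (fun t => F t i j) (dF i j)) ->
  (forall i j, is_derive x 1 (fun t => G t i j) (dG i j)) ->
  forall i j, is_derive x 1 (fun t => (F t *m G t) i j) ((dF *m G x + F x *m dG) i j).
Proof.
move=> hF hG i j.
rewrite (_ : (fun t => _) = fun t => \sum_k F t i k * G t k j); last first.
  by apply/funext => t; rewrite mxE.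
rewrite !mxE -big_split /=; apply: is_derive1_sum => k; exact: is_derive1M.
Qed.

Lemma is_derive1_scaleN f x df (a : R) : is_derive (a - x) 1 f df ->
  is_derive x 1 (fun t => f (a - t)) (- df).
Proof.
move=> hf; have h1 : is_derive x 1 (fun t => a - t) (-1).
  apply: is_derive_eq (is_deriveB (is_derive_cst a x 1) (is_derive_id x 1)) _.
  by rewrite sub0r.
have := @is_derive1_comp _ f (fun t => a - t) x _ _ hf h1.
by rewrite mulrN1.
Qed.

Lemma is_derive1_expRM a x : is_derive x 1 (fun t => expR (a * t)) (a * expR (a * x)).
Proof.
have h1 : is_derive x 1 (fun t => a * t) a.
  by apply: is_derive_eq (is_deriveZ a (is_derive_id x 1)) _; rewrite /GRing.scale/= mulr1.
have := @is_derive1_comp _ expR (fun t => a * t) x _ _ (is_derive_expR _) h1.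
by rewrite mulrC.
Qed.

End real_derivatives.

Lemma cvg_mx_entry (T : topologicalType) m n (u : nat -> 'M[T]_(m, n)) (M : 'M[T]_(m, n)) :
  (forall i j, (fun k => u k i j) @ \oo --> M i j) -> u @ \oo --> M.
Proof.
move=> uM A [P MP PA]; suff : \forall k \near \oo, forall i j, P i j (u k i j).
  by apply: filterS => k Pk; apply: PA.
by apply: filter_forall => i; apply: filter_forall => j; exact: uM.
Qed.

Section expmx.
Variables (R : realType) (n : nat) (B : 'M[R]_n).

Lemma scalemx_exp (t : R) k : (t *: B) ^+ k = t ^+ k *: B ^+ k.
Proof.
elim: k => [|k IH]; first by rewrite !expr0 scale1r.
by rewrite !exprS IH -!mulmxE -scalemxAl -scalemxAr scalerA.
Qed.

Lemma expmx_pow_entry_le k i j : `|(B ^+ k) i j| <= mxnorm1 B ^+ k.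
Proof.
elim: k i j => [|k IH] i j.
  by rewrite !expr0 -[1]/(1%:M) mxE; case: eqP => _; rewrite ?normr1// normr0.
rewrite !exprS -mulmxE mxE (le_trans (ler_norm_sum _ _ _))//.
apply: (@le_trans _ _ (\sum_l `|B i l| * mxnorm1 B ^+ k)).
  by apply: ler_sum => l _; rewrite normrM ler_wpM2l.
rewrite -mulr_suml ler_wpM2r ?exprn_ge0 ?mxnorm1_ge0//.
by rewrite /mxnorm1 [leRHS](bigD1 i)//= lerDl; apply: sumr_ge0 => l _; apply: sumr_ge0.
Qed.

(** Each entry of [e^(tB)] is a real power series in [t] with these coefficients, so convergence and
    differentiation reduce to scalar power series. *)
Let c (i j : 'I_n) (k : nat) : R := k`!%:R^-1 * (B ^+ k) i j.

Lemma is_cvg_expmx_entry i j t : cvgn (pseries (c i j) t).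
Proof.
apply: normed_cvg.
apply: series_le_cvg (is_cvg_series_exp_coeff (mxnorm1 B * `|t|)) => k /=.
- by [].
- by rewrite exp_coeff_ge0// mulr_ge0// mxnorm1_ge0.
- rewrite /c /exp_coeff /= !normrM normrX exprMn -mulrA mulrC.
  rewrite [`|_^-1|]ger0_norm ?invr_ge0//; apply: ler_wpM2r; first by rewrite invr_ge0.
  by apply: ler_wpM2r; [exact: exprn_ge0|exact: expmx_pow_entry_le].
Qed.

Lemma expmx_cvg t :
  series (fun k => k`!%:R^-1 *: (t *: B) ^+ k) @ \oo -->
  (\matrix_(i, j) limn (pseries (c i j) t) : 'M[R]_n).
Proof.
apply: cvg_mx_entry => i j; rewrite mxE.
rewrite (_ : (fun k => _) = pseries (c i j) t); first exact: is_cvg_expmx_entry.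
apply/funext => N; rewrite /pseries /series /= summxE.
by apply: eq_bigr => k _; rewrite scalemx_exp !mxE /c mulrAC mulrA.
Qed.

Lemma expmx_entryE t i j : expmx (t *: B) i j = limn (pseries (c i j) t).
Proof.
rewrite /expmx (cvg_lim _ (@expmx_cvg t)) ?mxE//.
Qed.

Lemma pseries_sum_lim (I : Type) (r : seq I) (w : I -> R) (a : I -> nat -> R) t :
  (forall i, cvgn (pseries (a i) t)) ->
  pseries (fun k => \sum_(i <- r) w i * a i k) t @ \oo -->
  \sum_(i <- r) w i * limn (pseries (a i) t).
Proof.
move=> ca.
rewrite (_ : pseries _ t = fun N => \sum_(i <- r) w i * pseries (a i) t N).
  apply: cvg_big => // [|i _]; first exact: add_continuous.
  by apply: cvgM; [exact: cvg_cst|exact: ca].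
apply/funext => N; rewrite /pseries /series /=.
under eq_bigr do rewrite mulr_suml.
rewrite exchange_big /=; apply: eq_bigr => i _.
by rewrite mulr_sumr; apply: eq_bigr => k _; rewrite mulrA.
Qed.

Lemma expmx_mull t i j :
  (B *m expmx (t *: B)) i j = limn (pseries (fun k => k`!%:R^-1 * (B ^+ k.+1) i j) t).
Proof.
rewrite mxE; under eq_bigr do rewrite expmx_entryE.
rewrite -(cvg_lim _
  (@pseries_sum_lim _ _ (B i) (c^~ j) t (fun l => @is_cvg_expmx_entry l j t)))//.
congr (limn (pseries _ t)); apply/funext => k.
by rewrite exprS -mulmxE mxE mulr_sumr; apply: eq_bigr => l _; rewrite /c mulrCA.
Qed.

Lemma expmx_mulr t i j :
  (expmx (t *: B) *m B) i j = limn (pseries (fun k => k`!%:R^-1 * (B ^+ k.+1) i j) t).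
Proof.
rewrite mxE; under eq_bigr do rewrite expmx_entryE mulrC.
rewrite -(cvg_lim _
  (@pseries_sum_lim _ _ (B^~ j) (c i) t (fun l => @is_cvg_expmx_entry i l t)))//.
congr (limn (pseries _ t)); apply/funext => k.
rewrite exprSr -mulmxE mxE mulr_sumr; apply: eq_bigr => l _; rewrite /c.
by rewrite mulrCA [B l j * _]mulrC.
Qed.

Lemma expmx_comm t : expmx (t *: B) *m B = B *m expmx (t *: B).
Proof. by apply/matrixP => i j; rewrite expmx_mull expmx_mulr. Qed.

(** These are the series of the entries of [B^m e^(tB)], that is, the m-th formal derivatives of the
    entries. Termwise differentiation needs their convergence for [m = 1] and [m = 2]. *)
Lemma is_cvg_expmx_shift m i j t :
  cvgn (pseries (fun k => k`!%:R^-1 * (B ^+ (m + k)) i j) t).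
Proof.
rewrite (_ : (fun k => _) = fun k => \sum_l (B ^+ m) i l * c l j k).
  by apply/cvg_ex; eexists; apply: pseries_sum_lim => l; exact: is_cvg_expmx_entry.
apply/funext => k; rewrite exprD -mulmxE mxE mulr_sumr.
by apply: eq_bigr => l _; rewrite /c mulrCA.
Qed.

Lemma is_derive_expmx (t : R) i j :
  is_derive t (1 : R) (fun t : R => expmx (t *: B) i j) ((B *m expmx (t *: B)) i j).
Proof.
rewrite expmx_mull (_ : (fun t => _) = fun t => limn (pseries (c i j) t)); last first.
  by apply/funext => s; rewrite expmx_entryE.
have dE m : pseries_diffs (fun k => k`!%:R^-1 * (B ^+ (m + k)) i j) =
    fun k => k`!%:R^-1 * (B ^+ (m.+1 + k)) i j.
  apply/funext => k; rewrite /pseries_diffs mulrA factS natrM invfM mulVKf//.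
  by rewrite addnS.
have d1 := dE 0; have d2 := dE 1.
have -> : (fun k => k`!%:R^-1 * (B ^+ k.+1) i j) = pseries_diffs (c i j).
  by rewrite -d1.
apply: (@pseries_snd_diffs _ _ (`|t| + 1)).
- exact: is_cvg_expmx_entry.
- by rewrite [pseries_diffs _]d1; exact: is_cvg_expmx_shift.
- by rewrite [pseries_diffs (c i j)]d1 d2; exact: is_cvg_expmx_shift.
- by rewrite [ltRHS]ger0_norm// ltrDl.
Qed.

Lemma expmx0 : expmx (0 *: B) = 1%:M.
Proof.
apply/matrixP => i j; rewrite expmx_entryE; apply: lim_near_cst => //.
exists 1 => // N /= N0.
rewrite /pseries /series /= -(prednK N0) big_nat_recl// big1 ?addr0.
  by rewrite /c fact0 invr1 mul1r expr0 mulr1.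
by move=> k _; rewrite expr0n mulr0.
Qed.

(** The product [e^(rB) e^((s+t-r)B)] has zero derivative in [r], because [B] commutes with its
    exponential; its values at [r = 0] and [r = s] are compared. *)
Lemma expmx_add s t : expmx ((s + t) *: B) = expmx (s *: B) *m expmx (t *: B).
Proof.
apply/matrixP => i j.
pose f (r : R) : R := (expmx (r *: B) *m expmx ((s + t - r) *: B)) i j.
have fd (r : R) : is_derive r (1 : R) f 0.
  have h1 := is_derive1_mulmx (fun i j => is_derive_expmx r i j)
    (dG := - (B *m expmx ((s + t - r) *: B)))
    (G := fun r => expmx ((s + t - r) *: B)).
  apply: is_derive_eq; first apply: h1.
    move=> k l; rewrite mxE.
    exact: (is_derive1_scaleN (f := fun r => expmx (r *: B) k l) (is_derive_expmx _ _ _)).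
  by rewrite mulmxN mulmxA expmx_comm subrr mxE.
have := is_derive_0_is_cst 0 s fd.
rewrite /f expmx0 mul1mx subr0 => ->.
by rewrite [s + t - s]addrAC subrr add0r.
Qed.

Lemma expmx_tr t : (expmx (t *: B))^T = expmx (t *: B^T).
Proof.
rewrite [RHS]/expmx; apply/esym/cvg_lim; first exact: norm_hausdorff.
apply: cvg_mx_entry => i j; rewrite mxE expmx_entryE.
rewrite (_ : (fun k => _) = pseries (c j i) t); first exact: is_cvg_expmx_entry.
apply/funext => N; rewrite /pseries /series /= summxE.
apply: eq_bigr => k _; have trX : (B^T) ^+ k = (B ^+ k)^T.
  elim: k => [|k IH]; first by rewrite !expr0 trmx1.
  by rewrite exprS exprSr IH -!mulmxE trmx_mul.
have -> : (t *: B^T) ^+ k = t ^+ k *: (B^T) ^+ k.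
  elim: k {trX} => [|k IH]; first by rewrite !expr0 scale1r.
  by rewrite !exprS IH -!mulmxE -scalemxAl -scalemxAr scalerA.
by rewrite trX !mxE /c mulrAC mulrA.
Qed.

End expmx.

(** * Exponential decay of [e^(tB)] *)

Section decay.
Variable R : realType.

Lemma continuous_is_derive (f df : R -> R) :
  (forall t : R, is_derive t (1 : R) f (df t)) -> continuous f.
Proof.
move=> fd t; apply/differentiable_continuous/derivable1_diffP.
by have [] := fd t.
Qed.

Lemma nincr_is_derive (f df : R -> R) (a : R) :
  (forall t : R, is_derive t (1 : R) f (df t)) -> (forall t, a <= t -> df t <= 0) ->
  forall s t, a <= s -> s <= t -> f t <= f s.
Proof.
move=> fd df0; apply: ler0_derive1_nincry.
- by move=> x _; have [] := fd x.
- move=> x; rewrite in_itv/= andbT => /ltW ax.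
  by rewrite derive1E; have [_ ->] := fd x; exact: df0.
- exact/continuous_subspaceT/(continuous_is_derive fd).
Qed.

(* Energy estimate for [w' = (a + ib) w + (g + ih)], where [w = u + iv]. *)
Lemma damped_decay (u v g h : R -> R) (a b c K : R) :
  0 < c -> a <= - (4 * c) ->
  (forall t : R, is_derive t (1 : R) u (a * u t - b * v t + g t)) ->
  (forall t : R, is_derive t (1 : R) v (b * u t + a * v t + h t)) ->
  (forall t, 0 <= t -> `|g t| <= K * expR (- (c * t)) /\ `|h t| <= K * expR (- (c * t))) ->
  exists K', forall t, 0 <= t ->
    `|u t| <= K' * expR (- (c * t)) /\ `|v t| <= K' * expR (- (c * t)).
Proof.
move=> c0 ac du dv gh.
(* [L] comes from Young's inequality, [2 (u g + v h) <= 2 c y + L e^(-2ct)] with [y = u^2 + v^2];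
   the terms in [b] cancel in [y']. Since [2 a <= -8 c], this leaves [y' <= -4 c y + L e^(-2ct)].
   The choice of [M] makes [2 c M = L], so that [psi] below is nonincreasing. The rate [c] of the
   forcing terms is kept, which allows iteration. *)
pose L := K ^+ 2 / c; pose M := L / (2 * c).
have L0 : 0 <= L by rewrite divr_ge0 ?sqr_ge0// ltW.
have M0 : 0 <= M by rewrite divr_ge0// mulr_ge0// ltW.
pose y t := u t * u t + v t * v t.
have y0 t : 0 <= y t by rewrite addr_ge0// -expr2 sqr_ge0.
pose dy t := 2 * a * y t + 2 * (u t * g t + v t * h t).
have dyE (t : R) : is_derive t (1 : R) y (dy t).
  have h1 := is_derive1M (du t) (du t); have h2 := is_derive1M (dv t) (dv t).
  by apply: is_derive_eq (is_deriveD h1 h2) _; rewrite /dy /y; ring.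
pose psi t := expR (4 * c * t) * y t - M * expR (2 * c * t).
pose dpsi t := (4 * c * expR (4 * c * t) * y t + expR (4 * c * t) * dy t)
               - M * (2 * c * expR (2 * c * t)).
have dpsiE (t : R) : is_derive t (1 : R) psi (dpsi t).
  have h1 := is_derive1M (is_derive1_expRM (4 * c) t) (dyE t).
  have h2 := is_deriveZ M (is_derive1_expRM (2 * c) t).
  exact: is_derive_eq (is_deriveB h1 h2) _.
have dpsi0 t : 0 <= t -> dpsi t <= 0.
  move=> t0; have [gK hK] := gh t t0.
  set e := expR (- (c * t)) in gK hK.
  have e0 : 0 < e by exact: expR_gt0.
  have e4 : expR (4 * c * t) = (e ^+ 4)^-1.
    by rewrite -expRM_natl -expRN; congr expR; ring.
  have e2 : expR (2 * c * t) = (e ^+ 2)^-1.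
    by rewrite -expRM_natl -expRN; congr expR; ring.
  have sqr_le z : `|z| <= K * e -> z ^+ 2 <= (K * e) ^+ 2.
    move=> zK; rewrite -real_normK ?num_real// lerXn2r// nnegrE//.
    exact: le_trans zK.
  have {}gK := sqr_le _ gK; have {}hK := sqr_le _ hK.
  have dyb : dy t <= - (4 * c) * y t + L * e ^+ 2.
    have LE : L * e ^+ 2 = c^-1 * (K * e) ^+ 2 by rewrite /L; field; rewrite gt_eqF.
    have cross w z : z ^+ 2 <= (K * e) ^+ 2 ->
        2 * (w * z) <= 2 * c * w ^+ 2 + 2^-1 * (L * e ^+ 2).
      move=> zK; rewrite LE.
      have : 0 <= (2 * c * w - z) ^+ 2 / (2 * c) by rewrite divr_ge0 ?sqr_ge0// mulr_ge0// ltW.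
      have -> : (2 * c * w - z) ^+ 2 / (2 * c) =
          2 * c * w ^+ 2 - 2 * (w * z) + 2^-1 * (c^-1 * z ^+ 2).
        by field; rewrite gt_eqF.
      have : c^-1 * z ^+ 2 <= c^-1 * (K * e) ^+ 2 by rewrite ler_pM2l ?invr_gt0.
      lra.
    have := cross (u t) _ gK; have := cross (v t) _ hK.
    have : a * y t <= - (4 * c) * y t by rewrite ler_wpM2r.
    have := y0 t; rewrite /dy {2 3 4 5}/y -!expr2 => y0' h1 h2 h3.
    have : 0 <= c * y t by rewrite mulr_ge0// ltW.
    rewrite /y -!expr2 in h1 *; lra.
  have -> : dpsi t = (e ^+ 4)^-1 * (4 * c * y t + dy t - L * e ^+ 2).
    rewrite /dpsi e4 e2 /M; field.
    by rewrite !gt_eqF.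
  rewrite pmulr_rle0; last by rewrite invr_gt0 exprn_gt0.
  lra.
have yb t : 0 <= t -> y t <= (M + y 0) * expR (- (c * t)) ^+ 2.
  move=> t0; have := nincr_is_derive dpsiE dpsi0 (lexx 0) t0.
  rewrite /psi !mulr0 expR0 mul1r mulr1; set e := expR (- (c * t)).
  have e0 : 0 < e by exact: expR_gt0.
  have e1 : e <= 1 by rewrite -expR0 ler_expR oppr_le0 mulr_ge0// ltW.
  have -> : expR (4 * c * t) = (e ^+ 4)^-1.
    by rewrite -expRM_natl -expRN; congr expR; ring.
  have -> : expR (2 * c * t) = (e ^+ 2)^-1.
    by rewrite -expRM_natl -expRN; congr expR; ring.
  move=> H.
  have {}H : (e ^+ 4)^-1 * y t <= M / e ^+ 2 + y 0 by lra.
  move: H; rewrite mulrC ler_pdivrMr ?exprn_gt0// => /le_trans; apply.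
  rewrite [leLHS]mulrDl [leRHS]mulrDl.
  have -> : M / e ^+ 2 * e ^+ 4 = M * e ^+ 2 by field; rewrite gt_eqF.
  rewrite lerD2l ler_wpM2l// -[leRHS]mul1r (exprD e 2 2) ler_wpM2r ?sqr_ge0//.
  by rewrite exprn_ile1// ltW.
(* With [m = M + y 0], the inequality [m <= (m + 1)^2] avoids a square root in the constant. *)
exists (M + y 0 + 1) => t t0; have := yb t t0; set e := expR _.
have e0 : 0 < e by exact: expR_gt0.
have m0 : 0 <= M + y 0 by rewrite addr_ge0.
have m1 : 0 <= M + y 0 + 1 by lra.
have key w : w ^+ 2 <= (M + y 0) * e ^+ 2 -> `|w| <= (M + y 0 + 1) * e.
  move=> wy; rewrite -(@ler_pXn2r _ 2)// ?nnegrE ?mulr_ge0 ?(ltW e0)//.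
  rewrite real_normK ?num_real// (le_trans wy)// exprMn ler_wpM2r ?sqr_ge0//.
  have := sqr_ge0 (M + y 0); rewrite sqrrD; lra.
have yE : y t = u t ^+ 2 + v t ^+ 2 by rewrite /y !expr2.
rewrite yE => yt; split; apply: key; apply: le_trans yt.
  by rewrite lerDl sqr_ge0.
by rewrite lerDr sqr_ge0.
Qed.

Variables (n : nat) (B : 'M[R]_n).

Let C : 'M[R[i]]_n := map_mx (real_complex R) B.
Let reM (M : 'M[R[i]]_n) : 'M[R]_n := map_mx (@complex.Re R) M.
Let imM (M : 'M[R[i]]_n) : 'M[R]_n := map_mx (@complex.Im R) M.

(** Complex matrices occur only as constant left factors of the real matrix [e^(tB)], so all
    derivatives are those of real functions. The rate is common to all entries, the constant is
    not. *)
Let decays (c : R) (M : 'M[R[i]]_n) := forall i j, exists K, forall t, 0 <= t ->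
  `|(reM M *m expmx (t *: B)) i j| <= K * expR (- (c * t)) /\
  `|(imM M *m expmx (t *: B)) i j| <= K * expR (- (c * t)).

Let reM_mulB M l : reM (M *m (C - l%:M)) =
  reM M *m B - complex.Re l *: reM M + complex.Im l *: imM M.
Proof.
apply/matrixP => i j; rewrite mulmxBr mul_mx_scalar !mxE.
rewrite raddfB /= raddf_sum /=.
rewrite -addrA; congr (_ + _).
  apply: eq_bigr => k _; rewrite !mxE; case: (M i k) => x y /=.
  by rewrite mulr0 subr0.
case: (M i j) l => x y [a b] /=; ring.
Qed.

Let imM_mulB M l : imM (M *m (C - l%:M)) =
  imM M *m B - complex.Im l *: reM M - complex.Re l *: imM M.
Proof.
apply/matrixP => i j; rewrite mulmxBr mul_mx_scalar !mxE.
rewrite raddfB /= raddf_sum /=.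
rewrite -addrA; congr (_ + _).
  apply: eq_bigr => k _; rewrite !mxE; case: (M i k) => x y /=.
  by rewrite mulr0 add0r.
case: (M i j) l => x y [a b] /=; ring.
Qed.

Let is_derive_mul_expmx (A : 'M[R]_n) i j (t : R) :
  is_derive t (1 : R) (fun t : R => (A *m expmx (t *: B)) i j)
    ((A *m B *m expmx (t *: B)) i j).
Proof.
have h := is_derive1_mulmx (F := fun=> A) (dF := 0) (x := t) _
  (fun i j => is_derive_expmx B t i j).
apply: is_derive_eq; first by apply: h => k l; rewrite mxE; exact: is_derive_cst.
by rewrite mul0mx add0r mulmxA.
Qed.

Let decays_step c M l : 0 < c -> complex.Re l <= - (4 * c) ->
  decays c (M *m (C - l%:M)) -> decays c M.
Proof.
move=> c0 lc H i j; have [K HK] := H i j.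
pose N := M *m (C - l%:M).
have := @damped_decay (fun t => (reM M *m expmx (t *: B)) i j)
  (fun t => (imM M *m expmx (t *: B)) i j)
  (fun t => (reM N *m expmx (t *: B)) i j)
  (fun t => (imM N *m expmx (t *: B)) i j) (complex.Re l) (complex.Im l) c K c0 lc.
apply => // t; apply: is_derive_eq (is_derive_mul_expmx _ _ _ _) _.
  have -> : reM M *m B = complex.Re l *: reM M - complex.Im l *: imM M + reM N.
    by rewrite reM_mulB; apply/matrixP => k m; rewrite !mxE; ring.
  by rewrite !mulmxDl mulNmx -!scalemxAl [LHS]mxE [X in X + _]mxE [X in X + _ + _]mxE
    [X in _ + X + _]mxE [X in _ - X + _]mxE.
have -> : imM M *m B = complex.Im l *: reM M + complex.Re l *: imM M + imM N.
  by rewrite imM_mulB; apply/matrixP => k m; rewrite !mxE; ring.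
by rewrite !mulmxDl -!scalemxAl [LHS]mxE [X in X + _]mxE [X in X + _ + _]mxE [X in _ + X + _]mxE.
Qed.

(* The partial products [M] of the [B - l_i], [l_i] the eigenvalues, satisfy
   [(M e^(tB))' = l M e^(tB) + M (B - l) e^(tB)]; by Cayley-Hamilton the full product
   vanishes, so that decay propagates back to the empty product. *)
Lemma expmx_decay : neg_spectrum B ->
  exists c K : R, [/\ 0 < c, 0 < K &
    forall t, 0 <= t -> mxnorm1 (expmx (t *: B)) <= K * expR (- (c * t))].
Proof.
move=> Bneg.
have [s sE] := closed_field_poly_normal (char_poly C).
(* The margin [4 c] is what [damped_decay] requires of every eigenvalue; it exists because there are
   finitely many of them. *)
have [c c0 sc] : exists2 c : R, 0 < c & forall l, l \in s -> complex.Re l <= - (4 * c).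
  have : forall l, l \in s -> complex.Re l < 0.
    move=> l ls; apply: Bneg; rewrite eigenvalue_root_char sE rootZ; last first.
      by rewrite lead_coef_eq0 monic_neq0// char_poly_monic.
    by rewrite root_prod_XsubC.
  elim: s {sE} => [|l s IH] sneg; first by exists 1.
  have [k ks|c c0 sc] := IH; first by apply: sneg; rewrite inE ks orbT.
  have l0 := sneg l (mem_head _ _).
  exists (Num.min c (- complex.Re l / 4)); first by rewrite lt_min c0/=; lra.
  move=> k; rewrite inE => /orP[/eqP ->|/sc].
    have : Num.min c (- complex.Re l / 4) <= - complex.Re l / 4 by rewrite ge_min lexx orbT.
    lra.
  have : Num.min c (- complex.Re l / 4) <= c by rewrite ge_min lexx.
  lra.
have prod0 : foldl (fun M l => M *m (C - l%:M)) 1%:M s = 0.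
  (* In dimension 0 all matrices are equal; Cayley-Hamilton is applied in positive dimension. *)
  case: n C sE => [|m] A sE; first exact: flatmx0.
  rewrite -[RHS](Cayley_Hamilton A) sE.
  rewrite (monicP (char_poly_monic _)) scale1r rmorph_prod /=.
  elim/last_ind: s {sE sc} => [|s l IH]; first by rewrite big_nil.
  rewrite -cats1 foldl_cat /= IH big_cat /= big_seq1 mulmxE; congr (_ * _).
  by rewrite rmorphB /= horner_mx_X horner_mx_C.
have : decays c (foldl (fun M l => M *m (C - l%:M)) 1%:M s).
  rewrite prod0 => i j; exists 0 => t _.
  rewrite /reM /imM (_ : map_mx _ 0 = 0); last by apply/matrixP => k l; rewrite !mxE.
  rewrite (_ : map_mx (@complex.Im R) 0 = 0); last by apply/matrixP => k l; rewrite !mxE.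
  by rewrite mul0mx mxE normr0 mul0r.
have decay1 : decays c (foldl (fun M l => M *m (C - l%:M)) 1%:M s) -> decays c 1%:M.
  elim/last_ind: s sc {sE prod0} => [//|s l IH] sc.
  rewrite -cats1 foldl_cat /= => /decays_step H; apply: IH.
    by move=> k ks; apply: sc; rewrite mem_rcons inE ks orbT.
  by apply: H => //; apply: sc; rewrite mem_rcons mem_head.
move=> /decay1 D1.
have re1 : reM 1%:M = 1%:M by apply/matrixP => i j; rewrite !mxE; case: eqP.
have /choice[k kP] : forall ij : 'I_n * 'I_n, exists K, forall t, 0 <= t ->
    `|expmx (t *: B) ij.1 ij.2| <= K * expR (- (c * t)).
  move=> [i j]; have [K HK] := D1 i j; exists K => t /HK[+ _].
  by rewrite re1 mul1mx.
exists c, (\sum_i \sum_j `|k (i, j)| + 1); split=> //.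
  by rewrite ltr_wpDl// sumr_ge0// => i _; rewrite sumr_ge0.
move=> t t0; apply: (@le_trans _ _ ((\sum_i \sum_j `|k (i, j)|) * expR (- (c * t)))).
  rewrite mulr_suml; apply: ler_sum => i _; rewrite mulr_suml; apply: ler_sum => j _.
  rewrite (le_trans (kP (i, j) _ t0))// ler_wpM2r ?expR_ge0//; exact: ler_norm.
by rewrite ler_wpM2r ?expR_ge0// lerDl.
Qed.

End decay.

(** * The covariance matrices *)

Lemma measurable_itvR (R : realType) (i : interval R) :
  measurable ([set` i] : set (measurableTypeR R)).
Proof. exact: measurable_itv. Qed.

Lemma integrable_expRN (R : realType) (a : R) : 0 < a ->
  lebesgue_measure.-integrable (`[0, +oo[ : set (measurableTypeR R))
    (fun s => (expR (- (a * s)))%:E).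
Proof.
move=> a0.
have H : lebesgue_measure.-integrable (`[0, +oo[ : set (measurableTypeR R))
    (EFin \o exponential_pdf a).
  by apply: integrableS (integrable_exponential_pdf a0).
have := integrableZl (measurable_itvR `[0, +oo[) a^-1 H.
apply: eq_integrable => // s; rewrite inE/= in_itv/= andbT => s0.
by rewrite exponential_pdfE// -EFinM mulKf ?gt_eqF// mulNr.
Qed.

Lemma Rintegral_lincomb d (T : measurableType d) (R : realType)
    (mu : {measure set T -> \bar R}) (D : set T) (I : Type) (r : seq I) (a : I -> R)
    (f : I -> T -> R) : measurable D ->
  (forall i, mu.-integrable D (EFin \o f i)) ->
  mu.-integrable D (EFin \o (fun x => \sum_(i <- r) a i * f i x)) /\
  \int[mu]_(x in D) (\sum_(i <- r) a i * f i x) =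
    \sum_(i <- r) a i * \int[mu]_(x in D) f i x.
Proof.
move=> mD fi; elim: r => [|i r [IH1 IH2]].
  split.
    rewrite (_ : EFin \o _ = cst 0%E); first exact: integrable0.
    by apply/funext => x /=; rewrite big_nil.
  rewrite big_nil; under eq_Rintegral do rewrite big_nil.
  by rewrite Rintegral_cst// mul0r.
have h1 : mu.-integrable D (EFin \o (fun x => a i * f i x)).
  have := integrableZl mD (a i) (fi i).
  by apply: eq_integrable => // x _ /=; rewrite EFinM.
split.
  have := integrableD mD h1 IH1.
  by apply: eq_integrable => // x _ /=; rewrite big_cons EFinD.
under eq_Rintegral do rewrite big_cons.
by rewrite RintegralD// RintegralZl// big_cons IH2.
Qed.

Section covariance.
Variables (R : realType) (n : nat) (Q B : 'M[R]_n).
Hypotheses (Q_sym : Q^T = Q) (Q_pos : posdefmx Q) (B_neg : neg_spectrum B).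

Local Notation E t := (expmx (t *: B)).
Local Notation mu := (@lebesgue_measure R).

Let F (s : R) : 'M[R]_n := expmx (s *: B) *m Q *m expmx (s *: B^T).

Let FE s : F s = E s *m Q *m (E s)^T.
Proof. by rewrite /F expmx_tr. Qed.

Let F_sym s : (F s)^T = F s.
Proof. by rewrite FE !trmx_mul trmxK Q_sym mulmxA. Qed.

Let D (t : \bar R) : set (measurableTypeR R) := [set s : R | (0 <= s%:E <= t)%E].

Let D_fin (t : R) : D t%:E = [set` `[0, t]].
Proof. by apply/seteqP; split => s; rewrite /D /= in_itv/= !lee_fin. Qed.

Let D_oo : D +oo%E = [set` `[0, +oo[].
Proof. by apply/seteqP; split => s; rewrite /D /= in_itv/= !lee_fin leey !andbT. Qed.

Let mD t : measurable (D t).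
Proof.
case: t => [t||]; [rewrite D_fin|rewrite D_oo|].
- exact: measurable_itvR.
- exact: measurable_itvR.
- rewrite (_ : D _ = set0) //; apply/seteqP; split => s //=.
  by rewrite /D /= leeNy_eq => /andP[].
Qed.

Let D_sub t : D t `<=` [set` `[0, +oo[].
Proof. by move=> s; rewrite /D /= in_itv/= andbT lee_fin => /andP[]. Qed.

Let continuous_expmx_entry i j : continuous (fun s : R => E s i j).
Proof. exact: continuous_is_derive (fun t => is_derive_expmx B t i j). Qed.

Let F_entry s i j : F s i j = \sum_k \sum_l E s i k * Q k l * E s j l.
Proof.
rewrite FE mxE exchange_big /=; apply: eq_bigr => l _.
by rewrite mxE mulr_suml; apply: eq_bigr => k _; rewrite mxE.
Qed.

Let measurable_F i j : measurable_fun setT (fun s : measurableTypeR R => F s i j).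
Proof.
under eq_fun do rewrite F_entry.
apply: measurable_sum => k; apply: measurable_sum => l.
by apply: measurable_funM; first apply: measurable_funM => //;
  apply: continuous_measurable_fun; exact: continuous_expmx_entry.
Qed.

Let F_bound : exists c K : R, [/\ 0 < c, 0 < K & forall s i j, 0 <= s ->
  `|F s i j| <= K * expR (- (c * s))].
Proof.
have [c [K [c0 K0 EK]]] := expmx_decay B_neg.
exists c, (K * mxnorm1 Q * K + 1); split=> //.
  by rewrite ltr_wpDl// !mulr_ge0 ?mxnorm1_ge0// ltW.
move=> s i j s0; rewrite (le_trans (ler_entry_mxnorm1 _ _ _))// FE.
apply: le_trans (ler_mxnorm1M _ _) _; rewrite mxnorm1_tr.
have e1 : expR (- (c * s)) <= 1 by rewrite -expR0 ler_expR oppr_le0 mulr_ge0// ltW.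
apply: (@le_trans _ _ (K * expR (- (c * s)) * mxnorm1 Q * K)); last first.
  have -> : forall e q : R, K * e * q * K = K * q * K * e by move=> e q; ring.
  by rewrite mulrDl mul1r lerDl expR_ge0.
apply: ler_pM; rewrite ?mxnorm1_ge0//.
  apply: le_trans (ler_mxnorm1M _ _) _.
  by apply: ler_wpM2r; rewrite ?mxnorm1_ge0 ?EK.
rewrite (le_trans (EK _ s0))// -[leRHS]mulr1; apply: ler_wpM2l => //.
exact: ltW.
Qed.

Let integrable_F t i j : mu.-integrable (D t) (EFin \o (fun s => F s i j)).
Proof.
have [c [K [c0 K0 FK]]] := F_bound.
apply: (integrableS (measurable_itvR `[0, +oo[) (mD t) (@D_sub t)).
apply: le_integrable (integrableZl (measurable_itvR `[0, +oo[) K (integrable_expRN c0)) => //.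
  apply/measurable_EFinP; apply: measurable_funTS; exact: measurable_F.
move=> s; rewrite /= in_itv/= andbT => s0.
by rewrite lee_fin (le_trans (FK _ _ _ s0))// ler_norm.
Qed.

(** The entries of [X A Y] are linear combinations of those of [A], so multiplication commutes with
    the entrywise integral. Row and column vectors give the quadratic form of [Q_t]; [X = e^(tB)]
    and its transpose give the conjugated covariance. *)
Lemma OU_cov_mul t p q (X : 'M[R]_(p, n)) (Y : 'M[R]_(n, q)) k l :
  mu.-integrable (D t) (EFin \o (fun s => (X *m F s *m Y) k l)) /\
  (X *m OU_cov Q B t *m Y) k l = \int[mu]_(s in D t) (X *m F s *m Y) k l.
Proof.
have XAY (A : 'M[R]_n) : (X *m A *m Y) k l =
    \sum_(ij : 'I_n * 'I_n) (X k ij.1 * Y ij.2 l) * A ij.1 ij.2.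
  rewrite -(pair_bigA _ (fun i j => X k i * Y j l * A i j)) /=.
  rewrite mxE exchange_big /=; apply: eq_bigr => j _.
  by rewrite mxE mulr_suml; apply: eq_bigr => i _; rewrite mulrAC.
have [h1 h2] := Rintegral_lincomb (index_enum ('I_n * 'I_n)%type)
  (fun ij => X k ij.1 * Y ij.2 l)
  (mD t) (fun ij : 'I_n * 'I_n => integrable_F t ij.1 ij.2).
split.
  by apply: eq_integrable h1 => // s _ /=; rewrite XAY.
under eq_Rintegral do rewrite XAY.
by rewrite h2 XAY; apply: eq_bigr => ij _; rewrite mxE.
Qed.

Lemma OU_cov_sym t : (OU_cov Q B t)^T = OU_cov Q B t.
Proof.
apply/matrixP => i j; rewrite mxE [LHS]mxE [RHS]mxE; apply: eq_Rintegral => s _.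
by rewrite -/(F s) -{1}F_sym mxE.
Qed.

(** The integral defining [Q_oo] is cut at [t]. On the tail the shift [s -> t + s] is used together
    with [F (t + s) = e^(tB) F(s) e^(tB)^T]. *)
Lemma OU_cov_split (t : R) : 0 <= t ->
  OU_cov Q B +oo%E = OU_cov Q B t%:E + E t *m OU_cov Q B +oo%E *m (E t)^T.
Proof.
move=> t0; apply/matrixP => i j; rewrite [RHS]mxE (OU_cov_mul _ _ _ _ _).2.
rewrite [LHS]mxE [X in X + _]mxE -/(D _) -/(D _).
have Dsplit : D +oo%E = [set` `[0, t[] `|` [set` `[t, +oo[].
  rewrite D_oo; apply/seteqP; split => s /=; rewrite !in_itv/= !andbT.
    by move=> ->; case: (leP t s); [right|left].
  by case=> [/andP[]//|]; exact: le_trans.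
have intF0t : mu.-integrable [set` `[0, t]] (EFin \o (fun s => F s i j)).
  by rewrite -D_fin; exact: integrable_F.
have FD := integrable_F +oo%E i j.
have disj : [disjoint [set` `[0, t[] & [set` `[t, +oo[]].
  apply/disj_setPS => s []; rewrite /= !in_itv/= andbT => /andP[_ st].
  by rewrite leNgt st.
rewrite Dsplit Rintegral_setU;
  [|exact: measurable_itvR|exact: measurable_itvR|by rewrite -Dsplit|exact: disj].
(* The cut leaves [[0, t[], while [OU_cov] integrates over [[0, t]]; the endpoint is a null set. *)
rewrite Rintegral_itv_bndo_bndc; last first.
  apply: integrableS intF0t; [exact: measurable_itvR|exact: measurable_itvR|].
  by move=> s /=; rewrite !in_itv/= => /andP[-> /ltW].
rewrite D_fin; congr (_ + _).
rewrite -Dsplit Rintegral_mkcond [RHS]Rintegral_mkcond /Rintegral; congr fine.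
have mFt : measurable_fun setT
    (EFin \o ((fun s : measurableTypeR R => F s i j) \_ [set` `[t, +oo[])).
  apply/measurable_EFinP.
  apply: (measurable_restrictT (fun s : measurableTypeR R => F s i j)
    (measurable_itvR `[t, +oo[)).1.
  by apply: measurable_funTS; exact: measurable_F.
rewrite [LHS](integral_translation t mFt).
apply: eq_integral => s _ /=; congr EFin; rewrite D_oo !patchE !mem_setE.
rewrite !in_itv/= !andbT lerDl.
by case: ifP => // s0; rewrite !FE expmx_add trmx_mul !mulmxA.
Qed.

(** The integrand of [<Q_t w, w>] is nonnegative and only its part over [[0, 1]] is kept, so the
    constant is the same for all [t >= 1], including [t = +oo]. *)
Lemma OU_cov_coercive : exists2 c : R, 0 < c &
  forall t w, (1 <= t)%E -> c * dotcV w w <= dotcV (OU_cov Q B t *m w) w.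
Proof.
have [c [K [c0 K0 EK]]] := expmx_decay B_neg.
pose q := mxnorm1 (invmx Q) + 1.
have q0 : 0 < q by rewrite ltr_wpDl// mxnorm1_ge0.
have Qq := posdefmx_coercive Q_sym Q_pos _ q0.
(* [L] bounds [e^(-sB)] for [s] in [[0, 1]], written as [e^(-B) e^((1-s)B)] because the decay
   estimate concerns nonnegative times. It gives [|w|^2 <= L^2 |e^(sB)^T w|^2]. *)
pose L := mxnorm1 (E (-1)) * K + 1.
have L0 : 0 < L by rewrite ltr_wpDl// mulr_ge0 ?mxnorm1_ge0// ltW.
exists (q^-1 * (L ^- 2)); first by rewrite mulr_gt0 ?invr_gt0 ?exprn_gt0.
move=> t w t1.
have dotE (A : 'M[R]_n) : dotcV (A *m w) w = (w^T *m A *m w) 0 0.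
  rewrite dotcVC mxE; under [RHS]eq_bigr => k _ do rewrite mxE mulr_suml.
  rewrite exchange_big /=; apply: eq_bigr => k _.
  by rewrite mxE mulr_sumr; apply: eq_bigr => l _; rewrite !mxE mulrA.
have [intF cE] := OU_cov_mul t w^T w 0 0; rewrite dotE {}cE.
pose h s := (w^T *m F s *m w) 0 0; rewrite -/h in intF *.
have hE s : h s = dotcV (Q *m ((E s)^T *m w)) ((E s)^T *m w).
  by rewrite /h -dotE FE -!mulmxA dotcV_mx.
have h0 s : 0 <= h s by rewrite hE posdefmx_ge0.
have h1 s : 0 <= s <= 1 -> q^-1 * L ^- 2 * dotcV w w <= h s.
  move=> /andP[s0 s1]; rewrite hE -mulrA; apply: le_trans (Qq _ _); last by rewrite lerDl.
  rewrite ler_wpM2l ?invr_ge0 ?(ltW q0)// ler_pdivrMl ?exprn_gt0//.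
  have wE : (E (- s))^T *m ((E s)^T *m w) = w.
    by rewrite mulmxA -trmx_mul -expmx_add subrr expmx0 trmx1 mul1mx.
  rewrite -{1 2}wE; apply: le_trans (dotcV_mx_sqr_le _ _) _.
  rewrite ler_wpM2r ?dotcV_ge0// mxnorm1_tr lerXn2r// ?nnegrE ?mxnorm1_ge0 ?(ltW L0)//.
  have -> : - s = -1 + (1 - s) by ring.
  rewrite expmx_add (le_trans (ler_mxnorm1M _ _))// /L -[leLHS]addr0 lerD//.
  rewrite ler_wpM2l ?mxnorm1_ge0// (le_trans (EK _ _))// ?subr_ge0//.
  rewrite -[leRHS]mulr1 ler_wpM2l ?(ltW K0)// -[leRHS]expR0 ler_expR oppr_le0.
  by rewrite mulr_ge0 ?subr_ge0// ltW.
have mh : measurable_fun setT (EFin \o h : measurableTypeR R -> \bar R).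
  apply/measurable_EFinP; rewrite /h.
  under eq_fun => s do rewrite mxE.
  apply: measurable_sum => l; apply: measurable_funM => //.
  under eq_fun => s do rewrite mxE.
  by apply: measurable_sum => k; apply: measurable_funM => //; exact: measurable_F.
rewrite -lee_fin /Rintegral fineK; last exact: integrable_fin_num.
pose I01 : set (measurableTypeR R) := [set` `[0, 1]].
have D1 : I01 `<=` D t.
  move=> s; rewrite /I01 /= in_itv/= /D /= lee_fin => /andP[-> s1].
  by rewrite (le_trans _ t1)// lee_fin.
apply: (@le_trans _ (\bar R) (\int[mu]_(s in I01) (h s)%:E)%E); last first.
  apply: ge0_subset_integral => //.
  - exact: measurable_itvR.
  - exact: measurable_funTS.
  - by move=> s _; rewrite lee_fin.
apply: (@le_trans _ _ (\int[mu]_(s in I01) (cst (q^-1 * L ^- 2 * dotcV w w)%:E s))%E).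
  rewrite integral_cst; last exact: measurable_itvR.
  by rewrite /= lebesgue_measure_itv/= lte_fin ltr01 oppr0 adde0 mule1.
apply: ge0_le_integral => //.
- exact: measurable_itvR.
- move=> s _; rewrite lee_fin !mulr_ge0 ?invr_ge0 ?exprn_ge0 ?dotcV_ge0//; exact: ltW.
- exact: measurable_funTS.
Qed.

Lemma OU_cov_bound : exists2 K : R, 0 < K & forall t : R, 1 <= t ->
  mxnorm1 (OU_cov Q B t%:E) <= K /\ mxnorm1 (OU_cov Q B +oo%E) <= K.
Proof.
have [c [K [c0 K0 EK]]] := expmx_decay B_neg.
pose S := OU_cov Q B +oo%E.
exists (mxnorm1 S + K * mxnorm1 S * K + 1).
  by rewrite ltr_wpDl// addr_ge0 ?mulr_ge0 ?mxnorm1_ge0// ltW.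
move=> t t1; have t0 : 0 <= t by rewrite (le_trans _ t1).
have EK' : mxnorm1 (E t) <= K.
  rewrite (le_trans (EK _ t0))// -[leRHS]mulr1 ler_wpM2l ?(ltW K0)//.
  by rewrite -expR0 ler_expR oppr_le0 mulr_ge0// ltW.
split; last first.
  by rewrite -/S -addrA lerDl addr_ge0// !mulr_ge0 ?mxnorm1_ge0// ltW.
have -> : OU_cov Q B t%:E = S - E t *m S *m (E t)^T.
  by apply/eqP; rewrite eq_sym subr_eq; apply/eqP; exact: OU_cov_split.
rewrite (le_trans (ler_mxnorm1D _ _))// mxnorm1N -addrA lerD2l.
apply: (@le_trans _ _ (K * mxnorm1 S * K)); last by rewrite lerDl.
apply: le_trans (ler_mxnorm1M _ _) _; rewrite mxnorm1_tr.
apply: ler_pM; rewrite ?mxnorm1_ge0//.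
rewrite (le_trans (ler_mxnorm1M _ _))//; apply: ler_wpM2r EK'; exact: mxnorm1_ge0.
Qed.

End covariance.

(** * The Mehler kernel *)

Lemma posdefmx_inv (R : realType) n (S : 'M[R]_n) : S^T = S -> posdefmx S ->
  posdefmx (invmx S).
Proof.
move=> S_sym S_pos x x0; set y := invmx S *m x.
have xE : x = S *m y by rewrite mulKVmx// posdefmx_unit.
have y0 : y != 0 by apply: contra x0 => /eqP y0; rewrite xE y0 mulmx0.
by rewrite dotcVC xE; exact: S_pos.
Qed.

Lemma coercive_posdefmx (R : realType) n (S : 'M[R]_n) (c : R) : 0 < c ->
  (forall x, c * dotcV x x <= dotcV (S *m x) x) -> posdefmx S.
Proof.
move=> c0 cS x x0; apply: lt_le_trans (cS x).
by rewrite mulr_gt0// dotcV_gt0.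
Qed.

Lemma expRN_lipschitz (R : realType) (l a b : R) : l <= a -> l <= b ->
  `|expR (- a) - expR (- b)| <= `|a - b| * expR (- l).
Proof.
wlog ab : a b / a <= b => [H la lb|la lb].
  by case: (leP a b) => [/H|/ltW/H]; [exact|rewrite distrC (distrC a); exact].
rewrite ger0_norm ?subr_ge0 ?ler_expR ?lerN2// ler0_norm ?subr_le0// opprB.
have -> : expR (- b) = expR (- a) * expR (- (b - a)) by rewrite -expRD; congr expR; ring.
rewrite -{1}[expR (- a)]mulr1 -mulrBr mulrC; apply: ler_pM.
- by rewrite subr_ge0 -[leRHS]expR0 ler_expR oppr_le0 subr_ge0.
- exact: expR_ge0.
- have := expR_ge1Dx (- (b - a)); lra.
- by rewrite ler_expR lerN2.
Qed.

Lemma powRN12 (R : realType) (a : R) : 0 < a -> a `^ (- 2^-1) = (Num.sqrt a)^-1.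
Proof. by move=> a0; rewrite powRN -powR12_sqrt// ltW. Qed.

Lemma powRN12_lipschitz (R : realType) (d a b : R) : 0 < d -> d <= a -> d <= b ->
  `|a `^ (- 2^-1) - b `^ (- 2^-1)| <= Num.sqrt d ^- 3 * `|a - b|.
Proof.
move=> d0 da db; have a0 := lt_le_trans d0 da; have b0 := lt_le_trans d0 db.
rewrite !powRN12//.
have [Ea Eb] : a = Num.sqrt a ^+ 2 /\ b = Num.sqrt b ^+ 2 by rewrite !sqr_sqrtr ?ltW.
rewrite {2}Ea {2}Eb; have := sqrtr_gt0 a; have := sqrtr_gt0 b; have := sqrtr_gt0 d.
have := ler_wsqrtr da; have := ler_wsqrtr db; rewrite a0 b0 d0.
set p := Num.sqrt a; set q := Num.sqrt b; set r := Num.sqrt d.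
move=> rq rp r0 q0 p0.
have -> : p^-1 - q^-1 = (q - p) * (p * q)^-1 by field; rewrite !gt_eqF.
have -> : p ^+ 2 - q ^+ 2 = (p - q) * (p + q) by ring.
rewrite !normrM distrC mulrCA; apply: ler_wpM2l => //.
have pq0 : 0 <= (p * q)^-1 by rewrite invr_ge0 mulr_ge0// ltW.
rewrite (ger0_norm pq0) (ger0_norm (addr_ge0 (ltW p0) (ltW q0))).
rewrite ler_pdivlMl ?exprn_gt0// ler_pdivrMr ?mulr_gt0//.
have h1 : r ^+ 2 <= p * q by rewrite expr2; apply: ler_pM => //; exact: ltW.
have h2 : r <= p + q by lra.
rewrite exprS; apply: ler_pM => //; [exact: ltW|exact/ltW/exprn_gt0].
Qed.

(** With [M = Q_oo], [a = e^(sB)] and [b = e^(tB)] the left-hand side is [Q_s - Q_t] up to sign, and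
    the right-hand side is linear in the difference of the exponentials. *)
Lemma sandwich_diff (R : realType) n (a b M : 'M[R]_n) :
  (M - b *m M *m b^T) - (M - a *m M *m a^T) = (a - b) *m M *m a^T + b *m M *m (a - b)^T.
Proof.
have -> : (a - b)^T = a^T - b^T by rewrite linearB.
rewrite !mulmxBl mulmxBr opprB [RHS]addrA subrK.
by rewrite [LHS]addrC addrA subrK.
Qed.

Lemma quad_form_diff (R : realType) n (P P' : 'M[R]_n) (z z' w : 'cV[R]_n) :
  P'^T = P' -> z = z' + w -> dotcV (P *m z) z - dotcV (P' *m z') z' =
    dotcV ((P - P') *m z) z + (dotcV (P' *m w) z + dotcV (P' *m w) z').
Proof.
move=> Psym zE.
have e1 : dotcV (P' *m z) z =
    dotcV (P' *m z') z' + (dotcV (P' *m w) z + dotcV (P' *m w) z').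
  rewrite {1}zE mulmxDr dotcVDl {1}zE dotcVDr (dotcV_sym Psym z' w).
  by ring.
have e2 : dotcV (P *m z) z = dotcV ((P - P') *m z) z + dotcV (P' *m z) z.
  by rewrite -dotcVDl -mulmxDl subrK.
by rewrite e2 e1; ring.
Qed.

(** For use with [P], [P'] the inverse covariances and [A], [A'] the matrices [e^(tB)], [e^(sB)].
    The variation of the matrix and that of its argument are estimated separately, each costing a
    factor [d] and a quadratic factor [X]. *)
Lemma quad_form_diff_le (R : realType) n (P P' A A' : 'M[R]_n) (x u : 'cV[R]_n)
    (K M d : R) (X := dotcV x x + dotcV u u) :
  P'^T = P' -> mxnorm1 P' <= K -> mxnorm1 (P - P') <= K * d -> mxnorm1 (A - A') <= K * d ->
  dotcV (A *m x - u) (A *m x - u) <= M * X ->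
  dotcV (A' *m x - u) (A' *m x - u) <= M * X ->
  `|dotcV (P *m (A *m x - u)) (A *m x - u) - dotcV (P' *m (A' *m x - u)) (A' *m x - u)|
    <= (K * M + K * K * (M + 1)) * d * X.
Proof.
move=> Psym P'K dP dA; set z := A *m x - u; set z' := A' *m x - u => zM zM'.
have zE : z = z' + (A - A') *m x by rewrite mulmxBl [RHS]addrC addrA subrK.
rewrite (quad_form_diff _ Psym zE).
have b1 : `|dotcV ((P - P') *m z) z| <= K * d * (M * X).
  apply: le_trans (ler_norm_dotcV_mx _ _ _) _; apply: ler_pM => //.
  - exact: mxnorm1_ge0.
  - by rewrite divr_ge0// addr_ge0 ?dotcV_ge0.
  - lra.
have b2 y : dotcV y y <= M * X ->
    `|dotcV (P' *m ((A - A') *m x)) y| <= K * (K * d) * ((M + 1) * X / 2).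
  move=> yX; rewrite mulmxA; apply: le_trans (ler_norm_dotcV_mx _ _ _) _; apply: ler_pM => //.
  - exact: mxnorm1_ge0.
  - by rewrite divr_ge0// addr_ge0 ?dotcV_ge0.
  - by rewrite (le_trans (ler_mxnorm1M _ _))// ler_pM ?mxnorm1_ge0.
  - have := dotcV_ge0 u; rewrite [(M + 1) * X]mulrDl mul1r {2}/X; lra.
have b3 := b2 _ zM; have b4 := b2 _ zM'.
apply: le_trans (le_trans (ler_normD _ _) (lerD b1 (le_trans (ler_normD _ _) (lerD b3 b4)))) _.
by rewrite le_eqVlt; apply/orP; left; apply/eqP; field.
Qed.

(** [G h e^(-q)] has the shape of the kernel: [G] is a constant, [h] the power of the determinant,
    [q] half the quadratic form. The common lower bound [l] retains the Gaussian decay, and [1 + Y]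
    is the polynomial loss. *)
Lemma prod_expR_diff_le (R : realType) (G h h' q q' l K d Y : R) :
  0 <= G -> 0 <= h' -> h' <= K -> 0 <= d -> 0 <= Y ->
  `|h - h'| <= K * d -> `|q - q'| <= K * d * Y -> l <= q -> l <= q' ->
  `|G * h * expR (- q) - G * h' * expR (- q')| <=
    G * ((K + 1) * K * d) * ((1 + Y) * expR (- l)).
Proof.
move=> G0 h0 hK d0 Y0 dh dq lq lq'; have K0 := le_trans h0 hK.
have -> : G * h * expR (- q) - G * h' * expR (- q') =
  G * ((h - h') * expR (- q) + h' * (expR (- q) - expR (- q'))) by ring.
rewrite normrM (ger0_norm G0) -mulrA ler_wpM2l// (le_trans (ler_normD _ _))//.
have b1 : `|(h - h') * expR (- q)| <= K * d * expR (- l).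
  by rewrite normrM (ger0_norm (expR_ge0 _)); apply: ler_pM; rewrite ?expR_ge0 ?ler_expR ?lerN2.
have b2 : `|h' * (expR (- q) - expR (- q'))| <= K * (K * d * Y * expR (- l)).
  rewrite normrM (ger0_norm h0); apply: ler_pM => //.
  by rewrite (le_trans (expRN_lipschitz lq lq'))// ler_wpM2r ?expR_ge0.
apply: le_trans (lerD b1 b2) _; rewrite -subr_ge0.
have e0 := expR_ge0 (- l).
have -> : (K + 1) * K * d * ((1 + Y) * expR (- l)) -
    (K * d * expR (- l) + K * (K * d * Y * expR (- l))) = K * d * expR (- l) * (Y + K) by ring.
by rewrite !mulr_ge0// addr_ge0.
Qed.

Local Opaque expmx OU_cov.

Section kernel.
Variables (R : realType) (n : nat) (Q B : 'M[R]_n).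
Hypotheses (Q_sym : Q^T = Q) (Q_pos : posdefmx Q) (B_neg : neg_spectrum B).

Local Notation E t := (expmx (t *: B)).
Local Notation S t := (OU_cov Q B t%:E).
Local Notation Soo := (OU_cov Q B +oo%E).

Definition OU_form (x : 'cV[R]_n) : R := dotcV (invmx Soo *m x) x.

Definition OU_kernel (t : R) (x u : 'cV[R]_n) : R := gauss_pdf (S t) (E t *m x - u).

Let quad t x u := dotcV (invmx (S t) *m (E t *m x - u)) (E t *m x - u).

Lemma OU_cov_posdef t : (1 <= t)%E -> posdefmx (OU_cov Q B t).
Proof.
move=> t1; have [c c0 cS] := OU_cov_coercive Q_sym Q_pos B_neg.
by apply: coercive_posdefmx c0 _ => x; exact: cS.
Qed.

Let Soo_sym := OU_cov_sym B Q_sym +oo%E.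
Let Soo_pos : posdefmx Soo := OU_cov_posdef (leey _).

Let S_sym t : (S t)^T = S t := OU_cov_sym B Q_sym t%:E.
Let S_pos t (t1 : 1 <= t) : posdefmx (S t).
Proof. by apply: OU_cov_posdef; rewrite lee_fin. Qed.

Lemma OU_form_coercive : exists2 k : R, 0 < k & forall x, k * dotcV x x <= OU_form x.
Proof.
pose K := mxnorm1 Soo + 1; have K0 : 0 < K by rewrite ltr_wpDl// mxnorm1_ge0.
exists K^-1 => [|x]; first by rewrite invr_gt0.
apply: posdefmx_coercive => //.
- exact: invmx_sym.
- exact: posdefmx_inv.
- by rewrite invmxK lerDl.
Qed.

(* Legendre duality for [Q_t] at a multiple of [w = Q_oo^-1 u], where
   [Q_t = Q_oo - e^(tB) Q_oo e^(tB)^T] and [l Q_oo <= Q_t]. The value [l = 0] would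
   give [a = b = p^-1]. *)
Lemma OU_quad_ge p : 1 < p -> exists a b : R, [/\ b < p^-1, p^-1 < a &
  forall t x u, 1 <= t -> a * OU_form u - b * OU_form x <= quad t x u].
Proof.
move=> p1; have [c c0 cS] := OU_cov_coercive Q_sym Q_pos B_neg.
have p0 : 0 < p by lra.
have n0 := mxnorm1_ge0 Soo.
(* The bounds [<Q_oo w, w> <= |Q_oo| |w|^2] and [c |w|^2 <= <Q_t w, w>] give [l Q_oo <= Q_t]; the
   extra [c] in the denominator ensures [l <= 1]. *)
pose l := c / (mxnorm1 Soo + c).
have l0 : 0 < l by rewrite divr_gt0// ltr_wpDl.
have l1 : l <= 1 by rewrite ler_pdivrMr ?ltr_wpDl//; lra.
have lS w t : 1 <= t -> l * dotcV (Soo *m w) w <= dotcV (S t *m w) w.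
  move=> t1; apply: le_trans (cS _ w _); last by rewrite lee_fin.
  have := ler_norm_dotcV_mx Soo w w => /ler_normlW.
  have -> : (dotcV w w + dotcV w w) / 2 = dotcV w w by field.
  move=> /(ler_wpM2l (ltW l0))/le_trans; apply.
  rewrite mulrA ler_wpM2r ?dotcV_ge0// /l mulrAC ler_pdivrMr ?ltr_wpDl//.
  by rewrite ler_wpM2l ?(ltW c0)// lerDl ltW.
(* These are the reciprocals of the exponents sought. They satisfy [a < p < b] and
   [a - 1 = (b - 1) (1 - l)], the relation that lets [r <= (1 - l) N u] pay for the terms in [r]. *)
pose a := 1 + (p - 1) * (1 - l ^+ 2); pose b := 1 + (p - 1) * (1 + l).
have l2 : l ^+ 2 <= 1 by rewrite expr_le1// ltW.
have a0 : 0 < a by rewrite /a ltr_pwDl// mulr_ge0; lra.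
have ap : a < p.
  have : 0 < (p - 1) * l ^+ 2 by rewrite mulr_gt0 ?exprn_gt0//; lra.
  rewrite /a; lra.
have pb : p < b.
  have : 0 < (p - 1) * l by rewrite mulr_gt0//; lra.
  rewrite /b; lra.
have b0 : 0 < b by lra.
exists a^-1, b^-1; split; rewrite ?ltf_pV2//.
move=> t x u t1; have t0 : 0 <= t by lra.
set w := invmx Soo *m u; set v := (E t)^T *m w.
have uE : u = Soo *m w by rewrite mulKVmx// posdefmx_unit.
have NuE : OU_form u = dotcV (Soo *m w) w by rewrite /OU_form -/w dotcVC {1}uE.
pose r := dotcV (Soo *m v) v.
have SwE : dotcV (S t *m w) w = OU_form u - r.
  rewrite NuE (OU_cov_split Q B_neg t0) mulmxDl dotcVDl /r.
  by rewrite /v -!mulmxA [X in _ + X - _]dotcV_mx addrK.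
have r0 : 0 <= r by exact: posdefmx_ge0.
have rl : r <= (1 - l) * OU_form u by have := lS w t t1; rewrite SwE -NuE; lra.
(* The first duality, at [-w / a], bounds the quadratic form but leaves the cross term [<v, x>]. The
   second, at [(b / a) v], trades that term for [N x] and a multiple of [r]. *)
have h1 := invmx_quad_ge (S_sym t) (S_pos t1) (E t *m x - u) (- a^-1 *: w).
have h2 := invmx_quad_ge Soo_sym Soo_pos x ((b / a) *: v).
move: h1 h2; rewrite -/(quad t x u) -/(OU_form x).
rewrite -!scalemxAr !dotcVZl !dotcVZr dotcVBr SwE -/r.
have -> : dotcV w (E t *m x) = dotcV v x by rewrite dotcVC dotcV_mx dotcVC.
have -> : dotcV w u = OU_form u by [].
set Nu := OU_form u in rl *; set Nx := OU_form x; set d := dotcV v x => h1 h2.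
apply: le_trans h1.
have h3 : 2 * (a^-1 * d) - (b / a ^+ 2) * r <= b^-1 * Nx.
  rewrite -ler_pdivrMl ?invr_gt0// invrK; apply: le_trans h2.
  by rewrite le_eqVlt; apply/orP; left; apply/eqP; field; rewrite gt_eqF.
have h4 : (b - 1) * r <= (a - 1) * Nu.
  have -> : a - 1 = (b - 1) * (1 - l) by rewrite /a /b; ring.
  by rewrite -mulrA ler_wpM2l//; lra.
have h5 : (a ^+ 2)^-1 * ((b - 1) * r) <= (a ^+ 2)^-1 * ((a - 1) * Nu).
  by rewrite ler_wpM2l// invr_ge0 exprn_ge0// ltW.
have e1 : (a ^+ 2)^-1 * ((b - 1) * r) = (b / a ^+ 2) * r - r / a ^+ 2.
  by field; rewrite gt_eqF.
have e2 : (a ^+ 2)^-1 * ((a - 1) * Nu) = a^-1 * Nu - Nu / a ^+ 2.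
  by field; rewrite gt_eqF.
have e3 : 2 * (- a^-1 * (d - Nu)) - - a^-1 * (- a^-1 * (Nu - r)) =
  2 * (a^-1 * Nu) - 2 * (a^-1 * d) - Nu / a ^+ 2 + r / a ^+ 2.
  by field; rewrite gt_eqF.
rewrite e3; lra.
Qed.

(** The derivative of an entry of [e^(tB)] is at most [|B| K e^(-ct)] in absolute value. With
    [M = |B| K / c], adding [M e^(-ct)] to plus or minus the entry therefore gives a nonincreasing
    function, which replaces integrating the derivative. *)
Lemma expmx_diff : exists c K : R, [/\ 0 < c, 0 < K,
  forall t, 0 <= t -> mxnorm1 (E t) <= K &
  forall s t, 0 <= s -> s <= t ->
    mxnorm1 (E t - E s) <= K * (expR (- (c * s)) - expR (- (c * t)))].
Proof.
have [c [K [c0 K0 EK]]] := expmx_decay B_neg.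
pose M := mxnorm1 B * K / c.
have M0 : 0 <= M by rewrite divr_ge0 ?mulr_ge0 ?mxnorm1_ge0// ltW.
have EKt t : 0 <= t -> mxnorm1 (E t) <= K.
  move=> t0; rewrite (le_trans (EK _ t0))// -[leRHS]mulr1 ler_wpM2l ?(ltW K0)//.
  by rewrite -[leRHS]expR0 ler_expR oppr_le0 mulr_ge0// ltW.
have diff (e : R) i j s t : `|e| = 1 -> 0 <= s -> s <= t ->
    e * (E t i j - E s i j) <= M * (expR (- (c * s)) - expR (- (c * t))).
  move=> e1 s0 st.
  pose f t := e * E t i j + M * expR (- c * t).
  pose df t := e * (B *m E t) i j + M * (- c * expR (- c * t)).
  have fd (r : R) : is_derive r (1 : R) f (df r).
    have h1 := is_deriveZ e (is_derive_expmx B r i j).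
    have h2 := is_deriveZ M (is_derive1_expRM (- c) r).
    exact: is_derive_eq (is_deriveD h1 h2) _.
  have df0 r : 0 <= r -> df r <= 0.
    move=> r0; rewrite /df.
    have : e * (B *m E r) i j <= mxnorm1 B * (K * expR (- (c * r))).
      rewrite (le_trans (ler_norm _))// normrM e1 mul1r.
      rewrite (le_trans (ler_entry_mxnorm1 _ _ _))// (le_trans (ler_mxnorm1M _ _))//.
      by rewrite ler_wpM2l ?mxnorm1_ge0// EK.
    have -> : M * (- c * expR (- c * r)) = - (mxnorm1 B * (K * expR (- (c * r)))).
      by rewrite [- c * r]mulNr /M; field; rewrite gt_eqF.
    by rewrite subr_le0.
  have := nincr_is_derive fd df0 s0 st; rewrite /f !mulNr; lra.
have nM0 : 0 <= n%:R * (n%:R * M) by apply: mulr_ge0 => //; exact: mulr_ge0.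
exists c, (n%:R * (n%:R * M) + K); split=> //.
- by rewrite ltr_wpDl.
- by move=> t /EKt/le_trans; apply; rewrite lerDr.
move=> s t s0 st.
have d0 : 0 <= expR (- (c * s)) - expR (- (c * t)).
  by rewrite subr_ge0 ler_expR lerN2 ler_pM2l.
apply: (@le_trans _ _ (n%:R * (n%:R * (M * (expR (- (c * s)) - expR (- (c * t))))))).
  apply: mxnorm1_le => i j; rewrite !mxE ler_norml -/(E t) -/(E s).
  have := diff (-1) i j s t; have := diff 1 i j s t.
  rewrite normrN normr1 => /(_ erefl s0 st) h1 /(_ erefl s0 st) h2.
  apply/andP; split; lra.
by rewrite !mulrA mulrDl lerDl mulr_ge0// ltW.
Qed.

(** Coercivity bounds [Q_t^-1]. An upper bound for [det (Q_t^-1)] then follows from the Leibniz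
    formula, and it is a lower bound for [det Q_t]. *)
Let invS_bound : exists2 K : R, 0 < K & forall t, 1 <= t ->
  [/\ mxnorm1 (S t) <= K, mxnorm1 (invmx (S t)) <= K & K^-1 <= \det (S t)].
Proof.
have [c c0 cS] := OU_cov_coercive Q_sym Q_pos B_neg.
have [K K0 SK] := OU_cov_bound Q B_neg.
pose L := n%:R * (n%:R * c^-1).
have L0 : 0 <= L by rewrite !mulr_ge0// invr_ge0 ltW.
have fL0 : 0 <= n`!%:R * L ^+ n by rewrite mulr_ge0// exprn_ge0.
exists (K + L + n`!%:R * L ^+ n) => [|t t1]; first by rewrite -addrA ltr_pwDl// addr_ge0.
have [SKt _] := SK t t1.
have iL : mxnorm1 (invmx (S t)) <= L.
  by apply: (invmx_norm_le (S_sym t) (S_pos t1) c0) => x; apply: cS; rewrite lee_fin.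
split.
- by rewrite (le_trans SKt)// -addrA lerDl addr_ge0.
- by rewrite (le_trans iL)// addrAC lerDr addr_ge0// ltW.
have dS := posdefmx_det_gt0 (S_sym t) (S_pos t1).
rewrite -[\det (S t)]invrK lef_pV2 ?posrE ?invr_gt0//; last first.
  by rewrite -addrA ltr_pwDl// addr_ge0.
rewrite -det_inv; have := det_norm_le iL => /ler_normlW/le_trans; apply.
by rewrite lerDr addr_ge0// ltW.
Qed.

Let S_diff : exists c K : R, [/\ 0 < c, 0 < K,
  forall t, 1 <= t -> mxnorm1 (E t) <= K,
  forall t, 1 <= t -> [/\ mxnorm1 (S t) <= K, mxnorm1 (invmx (S t)) <= K &
                          (\det (S t)) `^ (- 2^-1) <= K] &
  forall s t, 1 <= s -> s <= t -> let d := expR (- (c * s)) - expR (- (c * t)) in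
    [/\ 0 <= d, mxnorm1 (E t - E s) <= K * d,
        mxnorm1 (invmx (S t) - invmx (S s)) <= K * d &
        `|(\det (S t)) `^ (- 2^-1) - (\det (S s)) `^ (- 2^-1)| <= K * d]].
Proof.
have [c [K1 [c0 K10 EK dE]]] := expmx_diff.
have [K2 K20 SK] := invS_bound.
have d0 s t : s <= t -> 0 <= expR (- (c * s)) - expR (- (c * t)).
  by move=> st; rewrite subr_ge0 ler_expR lerN2 ler_pM2l.
have ge01 (t : R) : 1 <= t -> 0 <= t by move=> t1; lra.
pose K3 := 2 * (K1 * mxnorm1 Soo * K1).
have K30 : 0 <= K3 by rewrite !mulr_ge0 ?mxnorm1_ge0// ltW.
(* Both covariances are rewritten through [Q_oo], so their difference inherits the bound on
   [e^(tB) - e^(sB)]. *)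
have dS s t : 1 <= s -> s <= t ->
    mxnorm1 (S t - S s) <= K3 * (expR (- (c * s)) - expR (- (c * t))).
  move=> s1 st; have t1 := le_trans s1 st.
  have Es := EK s (ge01 _ s1); have Et := EK t (ge01 _ t1).
  have dEst := dE s t (ge01 _ s1) st.
  have -> : S t - S s = (E s - E t) *m Soo *m (E s)^T + E t *m Soo *m (E s - E t)^T.
    have h1 := OU_cov_split Q B_neg (ge01 _ s1); have h2 := OU_cov_split Q B_neg (ge01 _ t1).
    rewrite (canRL (addrK _) (esym h1)) (canRL (addrK _) (esym h2)).
    exact: sandwich_diff.
  set d := expR _ - expR _ in dEst *.
  have dEts : mxnorm1 (E s - E t) <= K1 * d by rewrite mxnorm1B.
  rewrite (le_trans (ler_mxnorm1D _ _))//.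
  rewrite (_ : K3 * d = K1 * d * mxnorm1 Soo * K1 + K1 * mxnorm1 Soo * (K1 * d)); last first.
    by rewrite /K3; ring.
  by apply: lerD; (rewrite (le_trans (ler_mxnorm1M _ _))// mxnorm1_tr; apply: ler_pM;
    rewrite ?mxnorm1_ge0// (le_trans (ler_mxnorm1M _ _))// ler_wpM2r// mxnorm1_ge0).
pose K2' := K2 + 1.
pose Kd := n`!%:R * (n%:R * K2' ^+ n).
have K2'1 : 1 <= K2' by rewrite /K2'; lra.
have Kd0 : 0 <= Kd.
  by apply: mulr_ge0 => //; apply: mulr_ge0 => //; apply: exprn_ge0; lra.
(* [K2^-1] bounds all the determinants from below, so [h] bounds their square roots from below. *)
pose h := Num.sqrt K2^-1.
have h0 : 0 < h by rewrite sqrtr_gt0 invr_gt0.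
have K2K3 : 0 <= K2 * K3 * K2 := mulr_ge0 (mulr_ge0 (ltW K20) K30) (ltW K20).
have hKK : 0 <= h ^- 3 * (Kd * K3).
  by apply: mulr_ge0; [rewrite invr_ge0 exprn_ge0// ltW|exact: mulr_ge0].
have hV0 : 0 <= h^-1 by rewrite invr_ge0 ltW.
pose K := K1 + K2 + K2 * K3 * K2 + h^-1 + h ^- 3 * (Kd * K3).
exists c, K; split=> //.
- by rewrite /K; lra.
- by move=> t /ge01/EK/le_trans; apply; rewrite /K; lra.
- move=> t t1; have [St iSt dSt] := SK t t1; split.
  + by rewrite (le_trans St)// /K; lra.
  + by rewrite (le_trans iSt)// /K; lra.
  + have dt : 0 < \det (S t) by rewrite (lt_le_trans _ dSt)// invr_gt0.
    rewrite powRN12//; apply: (@le_trans _ _ h^-1); last by rewrite /K; lra.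
    rewrite lef_pV2; [exact: ler_wsqrtr|by rewrite posrE sqrtr_gt0|by rewrite posrE].
move=> s t s1 st; have t1 := le_trans s1 st.
set d := expR _ - expR _; have d0' : 0 <= d by exact: d0.
have [Ss iSs dSs] := SK s s1; have [St iSt dSt] := SK t t1.
have dSst := dS s t s1 st; rewrite -/d in dSst.
split=> //.
- rewrite (le_trans (dE s t (ge01 _ s1) st))// -/d ler_wpM2r// /K; lra.
- rewrite invmx_resolvent; [|exact/posdefmx_unit/S_pos|exact/posdefmx_unit/S_pos].
  apply: (@le_trans _ _ (K2 * K3 * K2 * d)); last by rewrite ler_wpM2r// /K; lra.
  rewrite (_ : K2 * K3 * K2 * d = K2 * (K3 * d) * K2); last by ring.
  rewrite (le_trans (ler_mxnorm1M _ _))//; apply: ler_pM; rewrite ?mxnorm1_ge0//.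
  apply: le_trans (ler_mxnorm1M _ _) _; apply: ler_pM; rewrite ?mxnorm1_ge0//.
  by rewrite mxnorm1B.
- apply: (@le_trans _ _ (h ^- 3 * (Kd * K3) * d)); last by rewrite ler_wpM2r// /K; lra.
  have K2V : 0 < K2^-1 by rewrite invr_gt0.
  apply: le_trans (powRN12_lipschitz K2V dSt dSs) _; rewrite -/h -mulrA.
  rewrite ler_wpM2l ?invr_ge0 ?exprn_ge0 ?(ltW h0)//.
  have K2K2' : K2 <= K2' by rewrite /K2'; lra.
  apply: le_trans (det_lipschitz K2'1 (le_trans St K2K2') (le_trans Ss K2K2')) _.
  have -> : n`!%:R * (n%:R * (K2' ^+ n * mxnorm1 (S t - S s))) = Kd * mxnorm1 (S t - S s).
    by rewrite /Kd !mulrA.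
  by rewrite -[leRHS]mulrA; apply: ler_wpM2l.
Qed.

Let quad_diff : exists c K : R, [/\ 0 < c, 0 < K,
  forall t, 1 <= t -> (\det (S t)) `^ (- 2^-1) <= K &
  forall s t x u, 1 <= s -> s <= t -> let d := expR (- (c * s)) - expR (- (c * t)) in
    [/\ 0 <= d, `|quad t x u - quad s x u| <= K * d * (dotcV x x + dotcV u u) &
        `|(\det (S t)) `^ (- 2^-1) - (\det (S s)) `^ (- 2^-1)| <= K * d]].
Proof.
have [c [K [c0 K0 EK SK dSK]]] := S_diff.
(* From [|e^(tB) x - u|^2 <= 2 |e^(tB) x|^2 + 2 |u|^2]. *)
pose M := 2 * K ^+ 2 + 2.
have K2 : 0 <= K ^+ 2 by exact: sqr_ge0.
pose X (x u : 'cV[R]_n) := dotcV x x + dotcV u u.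
have X0 x u : 0 <= X x u by rewrite addr_ge0 ?dotcV_ge0.
have zM t x u : 1 <= t -> dotcV (E t *m x - u) (E t *m x - u) <= M * X x u.
  move=> t1; have h1 := dotcV_mx_sqr_le (E t) x.
  have h2 : dotcV (E t *m x) (E t *m x) <= K ^+ 2 * dotcV x x.
    apply: le_trans h1 _; rewrite ler_wpM2r ?dotcV_ge0//.
    rewrite lerXn2r ?nnegrE ?mxnorm1_ge0 ?(ltW K0)//.
    exact: EK.
  have := dotcV_ge0 (E t *m x + u); rewrite !dotcVBl !dotcVBr !dotcVDl !dotcVDr (dotcVC u).
  have := dotcV_ge0 x; have := dotcV_ge0 u.
  rewrite /M /X; set a := dotcV x x in h2 *; set b := dotcV u u => b0 a0.
  have := mulr_ge0 K2 a0; have := mulr_ge0 K2 b0; lra.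
pose L := K * M + K * K * (M + 1).
have L0 : 0 <= L by rewrite /L /M !(addr_ge0, mulr_ge0)// ltW.
exists c, (L + K); split=> //; first lra.
  by move=> t /SK[_ _ h]; rewrite (le_trans h)//; lra.
move=> s t x u s1 st; have t1 := le_trans s1 st.
have [] := dSK s t s1 st; set d := expR _ - expR _ => d0 dE dI dD.
split=> //; last by rewrite (le_trans dD)// ler_wpM2r//; lra.
have [_ iSs _] := SK s s1.
have Psym : (invmx (S s))^T = invmx (S s) by exact: invmx_sym.
apply: le_trans (quad_form_diff_le Psym iSs dI dE (zM t x u t1) (zM s x u s1)) _.
rewrite -/L -/(X x u) ler_wpM2r// ler_wpM2r// lerDl; exact: ltW.
Qed.

Lemma OU_kernel_bound p : 1 < p -> exists a b c K : R,
  [/\ p^-1 < a, b < p^-1, 0 < c /\ 0 < K,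
    forall t x u, 1 <= t -> OU_kernel t x u <= K * expR ((b * OU_form x - a * OU_form u) / 2) &
    forall s t x u, 1 <= s -> s <= t -> `|OU_kernel t x u - OU_kernel s x u| <=
      K * (expR (- (c * s)) - expR (- (c * t))) * expR ((b * OU_form x - a * OU_form u) / 2)].
Proof.
move=> p1; have [a [b [bp pa qab]]] := OU_quad_ge p1.
have [c [K [c0 K0 hK dK]]] := quad_diff.
have [k k0 kN] := OU_form_coercive.
(* Half the smaller gap, so that [a - e] and [b + e] stay strictly on their sides of [1/p]. *)
pose e := Num.min (a - p^-1) (p^-1 - b) / 2.
have e0 : 0 < e by rewrite divr_gt0// lt_min !subr_gt0 pa bp.
have [ea eb] : 2 * e <= a - p^-1 /\ 2 * e <= p^-1 - b.
  have -> : 2 * e = Num.min (a - p^-1) (p^-1 - b) by rewrite /e; field.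
  by rewrite !ge_min !lexx orbT.
pose G : R := (2 * pi) `^ (- (n%:R / 2)).
have G0 : 0 <= G := powR_ge0 _ _.
pose H t : R := (\det (S t)) `^ (- 2^-1).
have H0 t : 0 <= H t := powR_ge0 _ _.
have kE t x u : OU_kernel t x u = G * H t * expR (- (2^-1 * quad t x u)).
  by rewrite /OU_kernel /gauss_pdf mulNr.
(* The polynomial factor [X] is absorbed by moving [a] and [b] by [e]. *)
pose X (x u : 'cV[R]_n) := 1 + dotcV x x + dotcV u u.
pose l x u := (a * OU_form u - b * OU_form x) / 2.
pose l' x u := ((b + e) * OU_form x - (a - e) * OU_form u) / 2.
(* With [y = e (N x + N u) / 2], coercivity of [N] gives [|x|^2 + |u|^2 <= (2 / (e k)) y], and
   [1 + y <= e^y] turns this into [X <= kk e^y]. *)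
pose kk := 1 + 2 / (e * k).
have kk1 : 1 <= kk by rewrite lerDl divr_ge0// mulr_ge0// ltW.
have lE x u : X x u * expR (- l x u) <= kk * expR (l' x u).
  have -> : l' x u = e * (OU_form x + OU_form u) / 2 + - l x u by rewrite /l' /l; field.
  rewrite expRD mulrA ler_wpM2r ?expR_ge0//.
  set y := e * (OU_form x + OU_form u) / 2.
  have yk : e * k / 2 * (dotcV x x + dotcV u u) <= y.
    have := kN x; have := kN u; rewrite /y => hu hx.
    have -> : e * k / 2 * (dotcV x x + dotcV u u) =
        e / 2 * (k * dotcV x x + k * dotcV u u) by ring.
    have -> : e * (OU_form x + OU_form u) / 2 = e / 2 * (OU_form x + OU_form u) by ring.
    by rewrite ler_wpM2l ?lerD// divr_ge0// ltW.
  have yX : dotcV x x + dotcV u u <= 2 / (e * k) * y.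
    have -> : 2 / (e * k) = (e * k / 2)^-1 by rewrite invf_div.
    by rewrite ler_pdivlMl// divr_gt0// mulr_gt0.
  have y1 : 1 + y <= expR y := expR_ge1Dx y.
  have y0 : 0 <= y.
    by rewrite (le_trans _ yk)// mulr_ge0 ?addr_ge0 ?dotcV_ge0// divr_ge0// mulr_ge0// ltW.
  rewrite /X /kk; set m := 2 / (e * k) in yX *.
  have m0 : 0 <= m by rewrite divr_ge0// mulr_ge0// ltW.
  have : m * y <= m * expR y by rewrite ler_wpM2l//; lra.
  by rewrite mulrDl mul1r; lra.
have q2 t x u : 1 <= t -> l x u <= 2^-1 * quad t x u.
  by move=> t1; rewrite /l mulrC ler_pM2l ?invr_gt0//; exact: qab.
have X1 x u : 1 <= X x u by rewrite /X -addrA lerDl addr_ge0 ?dotcV_ge0.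
(* The constant is chosen large enough for both bounds: the first needs [G K kk], the second
   [G (K + 1) K kk]. *)
exists (a - e), (b + e), c, (2 * (G * K + 1) * (K + 1) * kk); split; [lra|lra| | |].
- by split=> //; rewrite !mulr_gt0//; [rewrite ltr_wpDl// mulr_ge0// ltW|lra|lra].
- move=> t x u t1; rewrite kE -/(l' x u).
  have h1 : G * H t <= 2 * (G * K + 1) * (K + 1).
    have : G * H t <= G * K by rewrite ler_wpM2l//; exact: hK.
    have : 0 <= G * K by rewrite mulr_ge0// ltW.
    nra.
  apply: (@le_trans _ _ (2 * (G * K + 1) * (K + 1) * (X x u * expR (- l x u)))).
    apply: ler_pM => //; first exact: mulr_ge0.
    apply: (@le_trans _ _ (expR (- l x u))); first by rewrite ler_expR lerN2 q2.
    by rewrite ler_peMl// expR_ge0.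
  rewrite -[leRHS]mulrA; apply: ler_wpM2l => //; apply: le_trans h1; exact: mulr_ge0.
move=> s t x u s1 st; have t1 := le_trans s1 st.
have [] := dK s t x u s1 st; set d := expR _ - expR _ => d0 dq dH.
have Y0 : 0 <= dotcV x x + dotcV u u by rewrite addr_ge0 ?dotcV_ge0.
have dq' : `|2^-1 * quad t x u - 2^-1 * quad s x u| <= K * d * (dotcV x x + dotcV u u).
  rewrite -mulrBr normrM ger0_norm ?invr_ge0// ler_pdivrMl// (le_trans dq)//.
  by rewrite ler_peMl ?ler1n// mulr_ge0// mulr_ge0// ltW.
rewrite !kE; apply: le_trans (prod_expR_diff_le G0 (H0 s) (hK s s1) d0 Y0 dH dq'
  (q2 t x u t1) (q2 s x u s1)) _.
rewrite addrA -/(X x u) -/(l' x u).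
have K0' := ltW K0; have kk0 : 0 <= kk by lra.
have GK0 : 0 <= G * ((K + 1) * K * d).
  by apply: mulr_ge0 => //; apply: mulr_ge0 => //; apply: mulr_ge0 => //; lra.
apply: le_trans (ler_wpM2l GK0 (lE x u)) _.
rewrite [leLHS]mulrA; apply: ler_wpM2r; first exact: expR_ge0.
rewrite -subr_ge0; have -> : 2 * (G * K + 1) * (K + 1) * kk * d - G * ((K + 1) * K * d) * kk =
  (G * K + 2) * (K + 1) * kk * d by ring.
have GK : 0 <= G * K by exact: mulr_ge0.
by apply: mulr_ge0 => //; apply: mulr_ge0 => //; apply: mulr_ge0; lra.
Qed.

End kernel.

Local Transparent expmx OU_cov.

(** * The variation of the semigroup *)

Section power_sums.
Variable R : realType.

(** Superadditivity of [x^rho] on nonnegative numbers, seen by writing [x^rho = x x^(rho - 1)] with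
    a nondecreasing second factor. This is what makes the final constant independent of [rho]. *)
Lemma sum_powR_le (rho : R) (I : Type) (r : seq I) (a : I -> R) : 1 <= rho ->
  (forall i, 0 <= a i) -> (\sum_(i <- r) a i `^ rho) `^ rho^-1 <= \sum_(i <- r) a i.
Proof.
move=> rho1 a0; have rho0 : 0 < rho by rewrite (lt_le_trans _ rho1).
have s0 (s : seq I) : 0 <= \sum_(i <- s) a i by exact: sumr_ge0.
have p0 (s : seq I) : 0 <= \sum_(i <- s) a i `^ rho.
  by apply: sumr_ge0 => i _; exact: powR_ge0.
have superadd (x y : R) : 0 <= x -> 0 <= y -> x `^ rho + y `^ rho <= (x + y) `^ rho.
  move=> x0 y0; have split z : 0 <= z -> z `^ rho = z * z `^ (rho - 1).
    move=> z0; have [->|zn0] := eqVneq z 0; first by rewrite mul0r powR0// gt_eqF.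
    by rewrite -{2}[z]powRr1// -powRD ?zn0 ?implybT// addrC subrK.
  rewrite !split ?addr_ge0// mulrDl.
  by apply: lerD; apply: ler_wpM2l => //; apply: ge0_ler_powR;
    rewrite ?subr_ge0 ?nnegrE ?addr_ge0// ?lerDl ?lerDr.
have H : \sum_(i <- r) a i `^ rho <= (\sum_(i <- r) a i) `^ rho.
  elim: r => [|i r IH]; first by rewrite !big_nil powR_ge0.
  by rewrite !big_cons (le_trans _ (superadd _ _ _ _))// lerD2l.
rewrite (le_trans (ge0_ler_powR _ _ _ H)) ?nnegrE ?invr_ge0 ?powR_ge0 ?(ltW rho0)//.
by rewrite -powRrM divff ?gt_eqF// powRr1.
Qed.

(** A supremum in the extended reals is nonnegative only once a nonnegative member is exhibited; the
    partition [1 < 2] provides one. *)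
Lemma variation_seminorm_ge0 (rho : R) (g : R -> R) :
  (0 <= variation_seminorm rho `[1%R, +oo[ g)%E.
Proof.
rewrite /variation_seminorm; set v := (\sum_(1 <= i < 2)
  `|g ((fun k : nat => k.+1%:R) i) - g ((fun k : nat => k.+1%:R) i.-1)| `^ rho) `^ rho^-1.
apply: (@le_trans _ _ v%:E); first by rewrite lee_fin powR_ge0.
apply: ereal_sup_ubound; exists 1%N, (fun k : nat => k.+1%:R); split => //.
  by move=> i _; rewrite ltr_nat.
by move=> i _; rewrite /= in_itv/= andbT ler1n.
Qed.

Lemma variation_seminorm_le (rho c K : R) (g : R -> R) : 1 <= rho -> 0 <= c -> 0 <= K ->
  (forall s t, 1 <= s -> s <= t ->
    `|g t - g s| <= (expR (- (c * s)) - expR (- (c * t))) * K) ->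
  (variation_seminorm rho `[1%R, +oo[ g <= K%:E)%E.
Proof.
move=> rho1 c0 K0 gK; apply: ge_ereal_sup => _ [N [t [N0 tlt tI ->]]].
rewrite lee_fin; apply: le_trans (sum_powR_le _ rho1 _) _; first by [].
have t1 i : (i <= N)%N -> 1 <= t i by move=> /tI; rewrite /= in_itv/= andbT.
have H m : (m <= N)%N -> \sum_(1 <= i < m.+1) `|g (t i) - g (t i.-1)| <=
    (expR (- (c * t 0%N)) - expR (- (c * t m))) * K.
  elim: m => [|m IH] mN; first by rewrite big_nil subrr mul0r.
  rewrite big_nat_recr//=.
  rewrite (le_trans (lerD (IH (ltnW mN)) (gK _ _ (t1 _ (ltnW mN)) (ltW (tlt _ mN)))))//.
  by rewrite -mulrDl le_eqVlt; apply/orP; left; apply/eqP; ring.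
rewrite (le_trans (H N _))// -[leRHS]mul1r ler_wpM2r//.
have : expR (- (c * t 0%N)) <= 1.
  by rewrite -[leRHS]expR0 ler_expR oppr_le0 mulr_ge0// (le_trans _ (t1 0%N _)).
by have := expR_ge0 (- (c * t N)); lra.
Qed.

End power_sums.

(* No measurability is assumed: the variation is a supremum over an uncountable set. *)
Lemma ge0_le_integral_nomeas d (T : measurableType d) (R : realType)
    (mu : {measure set T -> \bar R}) (f g : T -> \bar R) :
  (forall x, 0 <= f x)%E -> (forall x, f x <= g x)%E ->
  (\int[mu]_x f x <= \int[mu]_x g x)%E.
Proof.
move=> f0 fg; have g0 x : (0 <= g x)%E := le_trans (f0 x) (fg x).
(* The integral of a nonnegative function is the supremum over the simple functions below it, and
   this supremum is monotone for arbitrary functions. *)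
rewrite !ge0_integralTE//; apply: ge_ereal_sup => _ [h hf <-].
apply: ereal_sup_ubound; exists h => // x; exact: le_trans (hf x) (fg x).
Qed.

Section Lnorm_monotone.
Context d (T : measurableType d) (R : realType) (mu : {measure set T -> \bar R}).
Local Open Scope ereal_scope.

Lemma le_Lnorm_nomeas (p : R) (f g : T -> \bar R) : (0 < p)%R ->
  (forall x, 0 <= f x) -> (forall x, f x <= g x) ->
  'N[mu]_p%:E[f] <= 'N[mu]_p%:E[g].
Proof.
move=> p0 f0 fg; have g0 x : 0 <= g x := le_trans (f0 x) (fg x).
rewrite unlock; apply: gt0_ler_poweR.
- by rewrite invr_ge0 ltW.
- by rewrite in_itv/= leey andbT; apply: integral_ge0 => x _; exact: poweR_ge0.
- by rewrite in_itv/= leey andbT; apply: integral_ge0 => x _; exact: poweR_ge0.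
apply: ge0_le_integral_nomeas => x; first exact: poweR_ge0.
rewrite !gee0_abs//; apply: gt0_ler_poweR => //; first exact: ltW.
- by rewrite in_itv/= leey f0.
- by rewrite in_itv/= leey g0.
Qed.

Lemma ge0_LnormZ (p a : R) (f : T -> \bar R) : (0 < p)%R -> (0 <= a)%R ->
  measurable_fun setT f -> 'N[mu]_p%:E[(fun x => a%:E * f x)] = a%:E * 'N[mu]_p%:E[f].
Proof.
move=> p0 a0 mf; rewrite unlock.
under eq_integral => x _ do rewrite abseM poweRM ?abse_ge0//.
have I0 : 0 <= \int[mu]_x `|f x| `^ p by apply: integral_ge0 => x _; exact: poweR_ge0.
rewrite ge0_integralZl ?poweR_ge0//.
- rewrite poweRM ?poweR_ge0// -poweRrM divff ?gt_eqF// poweRe1 ?abse_ge0//.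
  by rewrite gee0_abs.
- apply: (measurableT_comp (measurable_poweR _)).
  exact: measurableT_comp.
- by move=> x _; exact: poweR_ge0.
Qed.

End Lnorm_monotone.

Lemma measurable_quad (R : realType) n (A : 'M[R]_n) :
  measurable_fun [set: 'cV[R]_n] (fun x => dotcV (A *m x) x).
Proof.
apply: measurable_sum => i.
have mA : measurable_fun [set: 'cV[R]_n] (fun x => (A *m x) i 0 : R).
  rewrite (_ : (fun _ => _) = (fun x : 'cV[R]_n => \sum_j A i j * x j 0)).
    by apply: measurable_sum => j; apply: measurable_funM => //; exact: measurable_cV_entry.
  by apply/funext => x; rewrite mxE.
by apply: measurable_funM => //; exact: measurable_cV_entry.
Qed.

(** * The pointwise bound for the variation *)

Section assembly.
Variables (R : realType) (n : nat) (Q B : 'M[R]_n).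
Hypotheses (Q_sym : Q^T = Q) (Q_pos : posdefmx Q) (B_neg : neg_spectrum B).

Local Notation N := (OU_form Q B).
Local Notation leb := (@lebesgue_cV R n).
Local Notation gam := (OU_gauss Q B +oo%E).
Local Notation Soo := (OU_cov Q B +oo%E).

Let mN : measurable_fun [set: 'cV[R]_n] N.
Proof. exact: measurable_quad. Qed.

Let mexpN (a : R) : measurable_fun [set: 'cV[R]_n] (fun x => expR (a * N x)).
Proof.
apply: measurableT_comp; first exact: measurable_expR.
by apply: measurable_funM => //; exact: mN.
Qed.

Lemma integral_expR_form_lty (a : R) : a < 0 ->
  (\int[leb]_x (expR (a * N x))%:E < +oo)%E.
Proof.
move=> a0; have [k k0 kN] := OU_form_coercive Q_sym Q_pos B_neg.
have ak : 0 < - a * k by rewrite mulr_gt0// oppr_gt0.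
apply: le_lt_trans (integral_cV_expR_dotcV_lty n ak).
apply: ge0_le_integral_nomeas => x; rewrite lee_fin ?expR_ge0//.
by rewrite ler_expR -mulrA mulNr opprK; have := kN x; nra.
Qed.

Let g0 : R := (2 * pi) `^ (- (n%:R / 2)) * (\det Soo) `^ (- 2^-1).

Let g0_gt0 : 0 < g0.
Proof.
rewrite mulr_gt0// powR_gt0//; first by rewrite mulr_gt0// pi_gt0.
by apply: posdefmx_det_gt0; [exact: OU_cov_sym|exact: OU_cov_posdef (leey _)].
Qed.

Let pdfE x : gauss_pdf Soo x = g0 * expR (- 2^-1 * N x).
Proof. by []. Qed.

(** The density of [gamma_oo] lowers the coefficient of [N] by 1/2, whence the integrability
    threshold [a < 1/2]. *)
Lemma integral_OU_gauss_expR (a : R) :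
  (\int[gam]_x (expR (a * N x))%:E = g0%:E * \int[leb]_x (expR ((a - 2^-1) * N x))%:E)%E.
Proof.
rewrite integral_gauss_measure; last by apply/measurable_EFinP; exact: mexpN.
rewrite -ge0_integralZl//; last 2 first.
- by apply/measurable_EFinP; exact: mexpN.
- by rewrite lee_fin ltW.
apply: eq_integral => x _; rewrite pdfE -!EFinM mulrCA -expRD.
by congr (_ * expR _)%:E; ring.
Qed.

Lemma OU_gauss_expR_lty (a : R) : a < 2^-1 -> (\int[gam]_x (expR (a * N x))%:E < +oo)%E.
Proof.
move=> a2; rewrite integral_OU_gauss_expR lte_mul_pinfty ?lee_fin ?(ltW g0_gt0)//.
by apply: integral_expR_form_lty; lra.
Qed.

(** The weight [e^(-a N / 2)] is [h] times the density of [gamma_oo], so the left-hand side is the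
    integral of [|f| h] under [gamma_oo]. In Hoelder's inequality [h] is in [L^q] because
    [q (1 - a) < 1], a rewriting of [1/p < a]. *)
Lemma integral_weight_le (p a : R) : 1 < p -> p^-1 < a -> exists2 C : R, 0 <= C &
  forall f : 'cV[R]_n -> R, measurable_fun setT f ->
  (\int[leb]_u (`|f u| * expR (- (a / 2) * N u))%:E <= C%:E * 'N[gam]_p%:E[EFin \o f])%E.
Proof.
move=> p1 pa; pose q := p / (p - 1).
have p0 : 0 < p by lra.
have q0 : 0 < q by rewrite divr_gt0//; lra.
have pq : p^-1 + q^-1 = 1 by rewrite /q; field; rewrite !gt_eqF//; lra.
pose h u := g0^-1 * expR ((1 - a) / 2 * N u).
have mh : measurable_fun [set: 'cV[R]_n] h by apply: measurable_funM => //; exact: mexpN.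
have Nh : ('N[gam]_q%:E[EFin \o h] < +oo)%E.
  rewrite unlock; apply: poweR_lty.
  rewrite (_ : (fun x => _) = (fun x =>
      (g0^-1 `^ q)%:E * (expR (q * ((1 - a) / 2) * N x))%:E)%E); last first.
    apply/funext => x /=; rewrite /h normrM !ger0_norm ?expR_ge0 ?invr_ge0 ?(ltW g0_gt0)//.
    by rewrite powRM ?expR_ge0 ?invr_ge0 ?(ltW g0_gt0)// -expRM -EFinM mulrAC [_ * q]mulrC.
  rewrite ge0_integralZl//; last 2 first.
  - by apply/measurable_EFinP; exact: mexpN.
  - by rewrite lee_fin powR_ge0.
  rewrite lte_mul_pinfty ?lee_fin ?powR_ge0//; apply: OU_gauss_expR_lty.
  have : q * (1 - a) < 1.
    rewrite -(@ltr_pM2l _ q^-1) ?invr_gt0// mulKf ?gt_eqF// mulr1; lra.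
  lra.
have Nh0 := Lnorm_ge0 gam q%:E (EFin \o h).
exists (fine 'N[gam]_q%:E[EFin \o h]) => [|f mf]; first exact: fine_ge0.
rewrite fineK ?ge0_fin_numE// muleC; apply: le_trans (hoelder gam mf mh p0 q0 pq).
rewrite Lnorm1 integral_gauss_measure; last first.
  by apply: measurableT_comp => //; apply/measurable_EFinP; exact: measurable_funM.
rewrite le_eqVlt; apply/orP; left; apply/eqP; apply: eq_integral => u _ /=.
have h0 : 0 <= h u by rewrite mulr_ge0 ?expR_ge0// invr_ge0 ltW.
rewrite pdfE normrM (ger0_norm h0) -EFinM /h.
have -> : expR (- (a / 2) * N u) =
    g0^-1 * expR ((1 - a) / 2 * N u) * (g0 * expR (- 2^-1 * N u)).
  by rewrite mulrACA mulVf ?gt_eqF// mul1r -expRD; congr expR; field.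
by rewrite mulrA.
Qed.

(** The substitution [u = e^(tB) x - y] is a reflection. The extended integrals on both sides agree
    for every measurable [f], so integrability does not enter here. *)
Lemma OU_semigroupE (t : R) (f : 'cV[R]_n -> R) x : measurable_fun setT f ->
  OU_semigroup Q B t f x = \int[leb]_u (f u * OU_kernel Q B t x u).
Proof.
move=> mf; set a := expmx (t *: B) *m x.
have mfa : measurable_fun setT (fun y : 'cV[R]_n => f (a - y) : R).
  exact: (measurableT_comp mf (measurable_reflection_cV a)).
rewrite /OU_semigroup /Rintegral -/a integral_gauss_measure; last exact/measurable_EFinP.
congr fine; rewrite -[RHS](integral_cV_reflection a); last first.
  apply/measurable_EFinP; apply: measurable_funM => //.
  exact: (measurableT_comp (measurable_gauss_pdf _) (measurable_reflection_cV a)).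
by apply: eq_integral => y _; rewrite /OU_kernel -/a -EFinM subKr.
Qed.

Lemma measurable_OU_kernel t x : measurable_fun setT (OU_kernel Q B t x).
Proof. exact: (measurableT_comp (measurable_gauss_pdf _) (measurable_reflection_cV _)). Qed.

(** [C] and [b] are fixed before [rho], [f] and [x]. A finite [L^p] norm makes [|f| e^(-a N / 2)]
    Lebesgue integrable, and the kernel bound then makes [H_t f(x)] a convergent integral at every
    [x], so that differences in [t] can be taken under the integral. *)
Lemma OU_variation_le p : 1 < p -> exists C b : R, [/\ 0 <= C, b < p^-1 &
  forall (rho : R) (f : 'cV[R]_n -> R), 1 <= rho -> measurable_fun setT f ->
    ('N[gam]_p%:E[EFin \o f] < +oo)%E -> forall x,
    (variation_seminorm rho `[1%R, +oo[ (fun t => OU_semigroup Q B t f x) <=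
     C%:E * 'N[gam]_p%:E[EFin \o f] * (expR (b / 2 * N x))%:E)%E].
Proof.
move=> p1; have [a [b [c [K [pa bp [c0 K0] kK dK]]]]] := OU_kernel_bound Q_sym Q_pos B_neg p1.
have [C C0 CW] := integral_weight_le p1 pa.
exists (K * C), b; split => //; first by rewrite mulr_ge0// ltW.
move=> rho f rho1 mf fp x; have {CW} := CW f mf.
pose w u := `|f u| * expR (- (a / 2) * N u); set Nf := ('N[gam]_p%:E[EFin \o f])%E in fp *.
have Nf0 : (0 <= Nf)%E by exact: Lnorm_ge0.
rewrite -/(w _) => wC; have w0 u : 0 <= w u by rewrite mulr_ge0// expR_ge0.
have mw : measurable_fun setT w.
  by apply: measurable_funM; [exact: measurableT_comp|exact: mexpN].
have wfin : (\int[leb]_u (w u)%:E < +oo)%E by rewrite (le_lt_trans wC)// lte_mul_pinfty.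
have wint : leb.-integrable setT (EFin \o w).
  apply/integrableP; split; first exact/measurable_EFinP.
  by rewrite (eq_integral (EFin \o w))// => u _ /=; rewrite ger0_norm.
pose W := \int[leb]_u w u.
have W0 : 0 <= W by apply: Rintegral_ge0.
have wfn : (\int[leb]_u (w u)%:E)%E \is a fin_num.
  by rewrite ge0_fin_numE//; apply: integral_ge0 => u _; rewrite lee_fin.
have WC : (W%:E <= C%:E * Nf)%E by rewrite /W /Rintegral fineK.
have eE u : expR ((b * N x - a * N u) / 2) = expR (b / 2 * N x) * expR (- (a / 2) * N u).
  by rewrite -expRD; congr expR; field.
have mk t : measurable_fun setT (fun u => f u * OU_kernel Q B t x u).
  by apply: measurable_funM => //; exact: measurable_OU_kernel.
pose e := expR (b / 2 * N x); have e0 : 0 <= e := expR_ge0 _.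
have scal (k : R) : leb.-integrable setT (EFin \o (fun u => k * w u)).
  by have := integrableZl measurableT k wint; apply: eq_integrable => // u _ /=; rewrite EFinM.
have kint t : 1 <= t -> leb.-integrable setT (EFin \o (fun u => f u * OU_kernel Q B t x u)).
  move=> t1; apply: le_integrable (scal (K * e)) => //; first exact/measurable_EFinP.
  move=> u _ /=; rewrite lee_fin normrM [leRHS]ger0_norm ?mulr_ge0 ?(ltW K0)//.
  rewrite /w mulrCA ler_wpM2l// ger0_norm; last exact: gauss_pdf_ge0.
  by rewrite (le_trans (kK _ _ _ t1))// eE mulrA.
have main : (variation_seminorm rho `[1%R, +oo[ (fun t => OU_semigroup Q B t f x)
    <= (K * e * W)%:E)%E.
  apply: (variation_seminorm_le rho1 (ltW c0)); first by rewrite !mulr_ge0// ltW.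
  move=> s t s1 st; have t1 := le_trans s1 st.
  rewrite !OU_semigroupE// -RintegralB//; [|exact: kint|exact: kint].
  set d := expR _ - expR _.
  have d0 : 0 <= d by rewrite subr_ge0 ler_expR lerN2 ler_pM2l.
  have dint : leb.-integrable setT (EFin \o (fun u =>
      f u * OU_kernel Q B t x u - f u * OU_kernel Q B s x u)).
    have := integrableB measurableT (kint _ t1) (kint _ s1).
    by apply: eq_integrable => // u _ /=; rewrite EFinB.
  apply: le_trans (le_normr_Rintegral _ dint) _ => //.
  rewrite (_ : d * (K * e * W) = \int[leb]_u (d * (K * e) * w u)); last first.
    by rewrite RintegralZl// !mulrA.
  apply: le_Rintegral => //.
  - by have := integrable_norm dint.
  - move=> u _; rewrite -mulrBr normrM /w mulrCA ler_wpM2l//.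
    by rewrite (le_trans (dK s t x u s1 st))// eE -/d -/e mulrA [K * d]mulrC !mulrA.
apply: le_trans main _.
rewrite [K * e * W](_ : _ = K * (W * e)); last by ring.
rewrite EFinM [(K * C)%:E]EFinM -!muleA lee_pmul2l ?lte_fin// EFinM muleA.
by apply: lee_wpmul2r => //; rewrite lee_fin.
Qed.

End assembly.

Theorem proposition4p1 (R : realType) (n : nat) (Q B : 'M[R]_n) (p : R)
    (n_ge1 : (1 <= n)%N) (Q_sym : Q^T = Q) (Q_pos : posdefmx Q)
    (B_neg : neg_spectrum B) (p_gt1 : 1 < p) :
  exists C : R, forall (rho : R) (f : 'cV[R]_n -> R),
    1 <= rho -> f \in Lfun (OU_gauss Q B +oo%E) p%:E ->
    ('N[OU_gauss Q B +oo]_p%:E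
       [(fun x => variation_seminorm rho `[1%R, +oo[
                    (fun t => OU_semigroup Q B t f x))]
     <= C%:E * 'N[OU_gauss Q B +oo]_p%:E[EFin \o f])%E.
Proof.
have [C [b [C0 bp var_le]]] := OU_variation_le Q_sym Q_pos B_neg p_gt1.
have p0 : 0 < p by lra.
set mu := OU_gauss Q B +oo%E.
(* [G] carries all the dependence on [x] of the pointwise bound; its [L^p] norm is finite because
   [p b < 1]. *)
pose G x := (expR (b / 2 * OU_form Q B x))%:E.
have NG : ('N[mu]_p%:E[G] < +oo)%E.
  rewrite unlock; apply: poweR_lty.
  rewrite (_ : (fun x => _) = (fun x => (expR (p * (b / 2) * OU_form Q B x))%:E)); last first.
    by apply/funext => x; rewrite /G /= ger0_norm ?expR_ge0// -expRM mulrAC [_ * p]mulrC.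
  apply: OU_gauss_expR_lty => //.
  have : p * b < 1 by rewrite -(@ltr_pM2l _ p^-1) ?invr_gt0// mulKf ?gt_eqF// mulr1.
  lra.
have NG0 : (0 <= 'N[mu]_p%:E[G])%E := Lnorm_ge0 _ _ _.
exists (C * fine 'N[mu]_p%:E[G]) => rho f rho1 fL.
have mf : measurable_fun setT f by move: fL; rewrite inE => /andP[/[!inE]].
have ff : ('N[mu]_p%:E[EFin \o f] < +oo)%E by move: fL; rewrite inE => /andP[_ /[!inE]].
have f0 : (0 <= 'N[mu]_p%:E[EFin \o f])%E := Lnorm_ge0 _ _ _.
pose A := C * fine 'N[mu]_p%:E[EFin \o f].
have A0 : 0 <= A by rewrite mulr_ge0// fine_ge0.
have AE : A%:E = (C%:E * 'N[mu]_p%:E[EFin \o f])%E by rewrite EFinM fineK// ge0_fin_numE.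
apply: (@le_trans _ _ (A%:E * 'N[mu]_p%:E[G])%E); last first.
  by rewrite AE EFinM fineK ?ge0_fin_numE// -!muleA lee_wpmul2l ?lee_fin// muleC.
have mG : measurable_fun setT G.
  apply/measurable_EFinP; apply: measurableT_comp; first exact: measurable_expR.
  by apply: measurable_funM => //; exact: measurable_quad.
(* Only the majorant [A G] is known to be measurable, so the comparison of norms is the one free of
   measurability. *)
rewrite -(ge0_LnormZ mu p0 A0 mG); apply: le_Lnorm_nomeas => // x.
  exact: variation_seminorm_ge0.
by rewrite AE; exact: var_le.
Qed.
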